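(* Let $F|K$ be an algebraic function field. The zero-dimensional places $P\in S(F|K)$ with finitely generated value group and with residue field $FP$ a finite extension of $K$ lie dense in $S(F|K)$ with respect to the patch topology.
   Context: An algebraic function field $F|K$ is a finitely generated field extension of positive transcendence degree; the characteristic is arbitrary. $S(F|K)$ is the set of all places $P$ of $F$ whose restriction to $K$ is the identity, up to equivalence. $\mathcal O_P$ is the valuation ring of $P$, $\mathcal M_P$ its maximal ideal, $FP$ its residue field. $P$ is zero-dimensional if $\dim P:=\operatorname{trdeg}(FP|K)=0$. The patch topology on $S(F|K)$ has as basic open sets the sets $\{P\in S(F|K)\mid a_1,\ldots,a_k\in\mathcal O_P;\ b_1,\ldots,b_\ell\in\mathcal M_P\}$ with $k,\ell\ge0$ and $a_i,b_j\in F$. *)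

(* Defs.v *)
From HB Require Import structures.
From mathcomp Require Import all_boot all_order all_algebra.
From mathcomp Require Import all_classical topology.
From mathcomp Require Import -(notations) mpoly.

Set Implicit Arguments.
Unset Strict Implicit.
Unset Printing Implicit Defensive.

Import GRing.Theory.
Local Open Scope ring_scope.
Local Open Scope classical_set_scope.

(* A field extension L|K is given by an embedding iota : {rmorphism K -> L}. *)
Section FieldExtensions.
Variables (K L : fieldType) (iota : {rmorphism K -> L}).

Definition alg_indep n (t : 'I_n -> L) : Prop :=
  forall p : mpoly n K, mmap iota t p = 0 -> p = 0.

(* The transcendence degree is the largest size of an algebraically
   independent family. *)
Definition trdeg_eq (n : nat) : Prop :=
  (exists t : 'I_n -> L, alg_indep t) /\
  forall m (t : 'I_m -> L), alg_indep t -> (m <= n)%N.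

(* L = K(s) for some finite s: no proper subfield of L contains K and s. *)
Definition finitely_generated_field : Prop :=
  exists s : seq L, forall S : {pred L},
    divring_closed S -> (forall c, iota c \in S) -> {subset s <= S} ->
    forall x, x \in S.

Definition function_field : Prop :=
  finitely_generated_field /\ exists2 n, (0 < n)%N & trdeg_eq n.

Definition finite_extension : Prop :=
  exists n (e : 'I_n -> L), forall x, exists c : 'I_n -> K,
    x = \sum_(i < n) iota (c i) * e i.

End FieldExtensions.

Section Places.
Variables (K F : fieldType) (iota : {rmorphism K -> F}).

(* A place P : F -> FP u {oo} over K, the value oo being None.  Surjectivity
   makes [residue] the residue field itself rather than an extension of it.
   P 1 = 1 follows from [placeK], where K is seen in FP through
   [residue_emb]. *)
Record place := Place {
  residue : fieldType;
  residue_emb : {rmorphism K -> residue};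
  place_fun :> F -> option residue;
  placeK : forall c, place_fun (iota c) = Some (residue_emb c);
  placeD : forall x y a b, place_fun x = Some a -> place_fun y = Some b ->
    place_fun (x + y) = Some (a + b);
  placeM : forall x y a b, place_fun x = Some a -> place_fun y = Some b ->
    place_fun (x * y) = Some (a * b);
  placeV : forall x, place_fun x = None -> place_fun x^-1 = Some 0;
  place_surj : forall a, exists x, place_fun x = Some a }.

Definition val_ring (P : place) : set F := [set x | P x != None].
Definition max_ideal (P : place) : set F := [set x | P x = Some 0].

Definition place_equiv (P Q : place) : Prop :=
  exists2 sigma : {rmorphism residue P -> residue Q},
    bijective sigma & forall x, Q x = omap sigma (P x).

(* The place class of P is encoded by its valuation ring, which determines it
   by [place_equivP].  The classes cannot be sets of places, since [place]
   quantifies over all fields and so lives in a larger universe. *)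
Record place_class := PlaceClass {
  class_ring : set F;
  class_ringP : exists P : place, val_ring P = class_ring }.

Definition class_of (P : place) : place_class :=
  PlaceClass (ex_intro _ P erefl).

Definition repr_place (P : place_class) : place := projT1 (cid (class_ringP P)).

Lemma val_ring_repr (P : place_class) : val_ring (repr_place P) = class_ring P.
Proof. by rewrite /repr_place; case: cid. Qed.

Lemma place_class_inj (P Q : place_class) : class_ring P = class_ring Q -> P = Q.
Proof.
case: P Q => [A pA] [B pB] /= eAB; subst B.
by congr PlaceClass; exact: Prop_irrelevance.
Qed.

End Places.

Section PlaceTheory.
Variables (K F : fieldType) (iota : {rmorphism K -> F}).
Implicit Types P Q : place iota.

Lemma place0 P : P 0 = Some 0.
Proof. by rewrite -(rmorph0 iota) placeK rmorph0. Qed.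

Lemma place1 P : P 1 = Some 1.
Proof. by rewrite -(rmorph1 iota) placeK rmorph1. Qed.

Lemma placeB P x y a b : P x = Some a -> P y = Some b -> P (x - y) = Some (a - b).
Proof.
move=> Px Py; apply: placeD => //; rewrite -mulN1r -[- b]mulN1r.
by apply: placeM => //; rewrite -(rmorph1 iota) -rmorphN placeK rmorphN rmorph1.
Qed.

Lemma max_idealP P x : max_ideal P x <-> x = 0 \/ ~ val_ring P x^-1.
Proof.
rewrite /max_ideal /val_ring /=; split=> [Px|[->|]]; last first.
- by move=> /negP; rewrite negbK => /eqP /placeV; rewrite invrK.
- exact: place0.
have [->|x0] := eqVneq x 0; [by left|right].
case Pv: (P x^-1) => [b|] // _.
have := placeM Px Pv; rewrite divff // place1 mul0r => -[] /eqP.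
by rewrite oner_eq0.
Qed.

Lemma place_equivP P Q : place_equiv P Q <-> val_ring P = val_ring Q.
Proof.
split=> [[s _ PQ]|ePQ].
  by apply/seteqP; split=> x; rewrite /val_ring /= PQ; case: (P x).
have dom x : (P x == None) = (Q x == None).
  have: val_ring P x <-> val_ring Q x by rewrite ePQ.
  by rewrite /val_ring /= => e; apply: negb_inj; apply/idP/idP => /e.
have ker x : P x = Some 0 <-> Q x = Some 0.
  by rewrite -[P x = _]/(max_ideal P x) -[Q x = _]/(max_ideal Q x) !max_idealP ePQ.
have tr x y a : P x = Some a -> P y = Some a -> Q x = Q y.
  move=> Px Py; have := dom x; have := dom y; rewrite Px Py.
  case Qx: (Q x) => [b|//]; case Qy: (Q y) => [c|//] _ _.
  have: Q (x - y) = Some 0 by apply/ker; rewrite (placeB Px Py) subrr.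
  by rewrite (placeB Qx Qy) => -[] /eqP; rewrite subr_eq0 => /eqP ->.
pose s (a : residue P) := odflt 0 (Q (projT1 (cid (place_surj a)))).
have sE x a : P x = Some a -> Q x = Some (s a).
  rewrite /s; case: cid => y /= Py Px; rewrite (tr _ _ _ Px Py).
  by have := dom y; rewrite Py; case: (Q y).
have sB : zmod_morphism s.
  move=> a b; have [x Px] := place_surj a; have [y Py] := place_surj b.
  have := sE _ _ (placeB Px Py).
  by rewrite (placeB (sE _ _ Px) (sE _ _ Py)) => -[].
have sM : monoid_morphism s.
  split=> [|a b]; first by have := sE _ _ (place1 P); rewrite place1 => -[].
  have [x Px] := place_surj a; have [y Py] := place_surj b.
  have := sE _ _ (placeM Px Py).
  by rewrite (placeM (sE _ _ Px) (sE _ _ Py)) => -[].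
pose sA := GRing.isZmodMorphism.Build _ _ s sB.
pose sMM := GRing.isMonoidMorphism.Build _ _ s sM.
pose sigma : {rmorphism residue P -> residue Q} := HB.pack s sA sMM.
have sQ x : Q x = omap sigma (P x).
  case Px: (P x) => [a|] /=; first exact: sE.
  by have := dom x; rewrite Px eqxx => /esym/eqP.
exists sigma => //.
have surj b : exists a, sigma a = b.
  have [x Qx] := place_surj b; have := sQ x; rewrite Qx.
  by case: (P x) => [a|] //= [->]; exists a.
exists (fun b => projT1 (cid (surj b))) => [a|b]; case: cid => //= c sc.
by apply: (fmorph_inj sigma).
Qed.

Lemma class_of_eq P Q : class_of P = class_of Q <-> place_equiv P Q.
Proof.
rewrite place_equivP; split=> [/(congr1 (@class_ring _ _ _)) //|e].
exact: place_class_inj.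
Qed.

Lemma class_of_repr (P : place_class iota) : class_of (repr_place P) = P.
Proof. by apply: place_class_inj; rewrite /= val_ring_repr. Qed.

End PlaceTheory.

Section PatchTopology.
Variables (K F : fieldType) (iota : {rmorphism K -> F}).
Local Notation S := (place_class iota).

HB.instance Definition _ := gen_eqMixin S.
HB.instance Definition _ := gen_choiceMixin S.

Definition patch_index := (seq F * seq F)%type.
HB.instance Definition _ := Choice.on patch_index.
HB.instance Definition _ := isPointed.Build patch_index ([::], [::]).

Definition patch_basic (ab : patch_index) : set S :=
  [set P | (forall a, a \in ab.1 -> val_ring (repr_place P) a) /\
           (forall b, b \in ab.2 -> max_ideal (repr_place P) b)].

Let patch_cover : \bigcup_(ab in [set: patch_index]) patch_basic ab = setT.
Proof. by apply/seteqP; split=> // P _; exists ([::], [::]). Qed.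

Let patch_join (i j : patch_index) (P : S) : setT i -> setT j ->
  patch_basic i P -> patch_basic j P ->
  exists k, [/\ setT k, patch_basic k P &
    patch_basic k `<=` patch_basic i `&` patch_basic j].
Proof.
move=> _ _ [iP1 iP2] [jP1 jP2]; exists (i.1 ++ j.1, i.2 ++ j.2); split => //.
  by split=> a /=; rewrite mem_cat => /orP[]; auto.
move=> Q [Q1 Q2]; split; split=> a ai.
- by apply: Q1; rewrite mem_cat ai.
- by apply: Q2; rewrite mem_cat ai.
- by apply: Q1; rewrite mem_cat ai orbT.
- by apply: Q2; rewrite mem_cat ai orbT.
Qed.

HB.instance Definition _ := isBaseTopological.Build S patch_cover patch_join.

End PatchTopology.

Section PlaceInvariants.
Variables (K F : fieldType) (iota : {rmorphism K -> F}).
Implicit Types P : place iota.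

Definition zero_dimensional_place P : Prop := trdeg_eq (residue_emb P) 0.

(* x and y have the same image in the value group F^* / O_P^*. *)
Definition same_value P (x y : F) : Prop :=
  val_ring P (x / y) /\ val_ring P (y / x).

(* The value group F^* / O_P^* (written multiplicatively here) is generated
   by the classes of finitely many elements g i of F^*. *)
Definition value_group_fg P : Prop :=
  exists n (g : 'I_n -> F), (forall i, g i != 0) /\
    forall x, x != 0 -> exists e : 'I_n -> int,
      same_value P x (\prod_(i < n) g i ^ e i).

Definition residue_finite P : Prop := finite_extension (residue_emb P).

End PlaceInvariants.

(* Main.v *)
Require Import Defs.
From HB Require Import structures.
From mathcomp Require Import all_boot all_order all_algebra.
From mathcomp Require Import all_classical topology.
From mathcomp Require Import -(notations) mpoly.
From mathcomp Require Import ring.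

(** Given a place P and finitely many elements a_i in its valuation ring and b_j
    in its maximal ideal, one must find a place Q, with value group finitely
    generated and residue field finite over K, such that the a_i are finite and
    the b_j vanish at Q.  Dividing by a b_j of largest value, one may assume that
    there is a single nonzero b ([patch_small_place]).

    Places with small residue field and value group are built one variable at a
    time.  If F is a function field in one variable over E, every place of F over
    E that is not trivial has finite residue field and a value group in which some
    cyclic subgroup has finite index: for z of positive value, F is finite over
    E(z), on which the place is the z-adic one, and linear relations over E[z] of
    bounded length bound the residue degree and the number of values modulo that
    of z ([curve_place_small]).  If E is itself generated over K by finitely many
    elements, the residue field, being finite over E, has by induction such a
    place, which is then composed with the first one ([small_place_exists],
    [comp_value_group_fg]).  Places over E that are finite on prescribed elements
    and vanish at b exist as soon as 1/b is not integral over the ring of these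
    elements, by Chevalley's theorem ([chevalley]).

    It remains to choose E so that b stays a nonunit ([line_with_nonunit]).  By
    Noether normalization within the valuation ring of P, the a_i and b are
    integral over a polynomial ring K[t_1, ..., t_n]
    ([noether_normalization]).  Let c be the constant coefficient of the minimal
    polynomial of b over K(t), that is the norm of b up to sign and powers.  It
    vanishes at P and is therefore transcendental over K; hence it is
    transcendental over the field E generated by all the t_j except some t_i
    ([alg_indep_pick]).  Then b is not a unit in the integral closure of E[t_i],
    since otherwise c would be a unit of E[t_i].  In geometric terms, this finds a
    divisor along which b vanishes. *)

Set Implicit Arguments.
Unset Strict Implicit.
Unset Printing Implicit Defensive.

Import GRing.Theory.
Local Open Scope ring_scope.

(** * Fraction fields of images *)

Section ImageField.
Variables (R : comNzRingType) (F : fieldType) (f : {rmorphism R -> F}).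

(** With [f] the evaluation of polynomials at a family t, this is the subfield
    K(t) of [F]. *)
Definition imfrac : {pred F} :=
  [pred x | `[< exists p q, f q != 0 /\ x = f p / f q >]].

Lemma imfracP x : reflect (exists p q, f q != 0 /\ x = f p / f q) (x \in imfrac).
Proof. exact: asboolP. Qed.

Lemma imfrac_closed : divring_closed imfrac.
Proof.
split=> [|x y /imfracP[p [q [q0 ->]]] /imfracP[r [s [s0 ->]]]
         |x y /imfracP[p [q [q0 ->]]] /imfracP[r [s [s0 ->]]]]; apply/imfracP.
- by exists 1, 1; rewrite rmorph1 oner_neq0 divr1.
- exists (p * s - r * q), (q * s); rewrite rmorphB !rmorphM /= mulf_neq0 //.
  by rewrite -[- (f r / f s)]mulNr addf_div // mulNr.
have [->|r0] := eqVneq (f r) 0.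
  by exists 0, 1; rewrite mul0r invr0 mulr0 rmorph1 rmorph0 mul0r oner_neq0.
exists (p * s), (q * r); rewrite !rmorphM mulf_neq0 //; split=> //.
by rewrite invf_div mulf_div.
Qed.

HB.instance Definition _ := GRing.isDivringClosed.Build F imfrac imfrac_closed.

Lemma imfrac_id r : f r \in imfrac.
Proof. by apply/imfracP; exists r, 1; rewrite rmorph1 oner_neq0 divr1. Qed.

(** The same subfield as a field type, so that it can serve as a base field for
    places, algebraicity and polynomials. *)
Record imfield := ImField { imval : F; imvalP : imval \in imfrac }.

HB.instance Definition _ := [isSub for imval].
HB.instance Definition _ := [Choice of imfield by <:].
HB.instance Definition _ := [SubChoice_isSubComUnitRing of imfield by <:].
HB.instance Definition _ := [SubComUnitRing_isSubIntegralDomain of imfield by <:].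
HB.instance Definition _ := [SubIntegralDomain_isSubField of imfield by <:].

Definition to_imfield r : imfield := ImField (imfrac_id r).

Lemma to_imfield_zmod : zmod_morphism to_imfield.
Proof. by move=> x y; apply: val_inj; rewrite /= rmorphB. Qed.
Lemma to_imfield_monoid : monoid_morphism to_imfield.
Proof. by split=> [|x y]; apply: val_inj; rewrite /= (rmorph1, rmorphM). Qed.
HB.instance Definition _ := GRing.isZmodMorphism.Build R imfield to_imfield to_imfield_zmod.
HB.instance Definition _ := GRing.isMonoidMorphism.Build R imfield to_imfield to_imfield_monoid.

Definition imemb : imfield -> F := val.
HB.instance Definition _ := GRing.RMorphism.on imemb.
End ImageField.

(** * Evaluation, integral and algebraic elements *)

Section Evaluation.
Variables (R : comNzRingType) (F : fieldType) (f : {rmorphism R -> F}) (s : F).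

Lemma comm_eval : commr_rmorph f s.
Proof. by move=> r; apply: mulrC. Qed.

Definition eval_at : {poly R} -> F := horner_morph comm_eval.

HB.instance Definition _ := GRing.RMorphism.copy eval_at (horner_morph comm_eval).

Lemma eval_atE p : eval_at p = (map_poly f p).[s]. Proof. by []. Qed.
Lemma eval_atX : eval_at 'X = s. Proof. by rewrite eval_atE map_polyX hornerX. Qed.
Lemma eval_atC c : eval_at c%:P = f c. Proof. by rewrite eval_atE map_polyC hornerC. Qed.

Lemma eval_at_in (S : subringClosed F) p :
  (forall c, f c \in S) -> s \in S -> eval_at p \in S.
Proof.
move=> fS sS; rewrite eval_atE rpred_horner //.
by apply/polyOverP => i; rewrite coef_map fS.
Qed.
End Evaluation.

Lemma mmap_in (R : nzRingType) (F : comNzRingType) n (f : R -> F)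
    (t : 'I_n -> F) (S : subringClosed F) p :
  (forall c, f c \in S) -> (forall i, t i \in S) -> mmap f t p \in S.
Proof.
move=> fS tS; rewrite /mmap rpred_sum // => m _; rewrite rpredM //.
by rewrite /mmap1 rpred_prod // => i _; rewrite rpredX.
Qed.

Lemma imfrac_sub (R R' : comNzRingType) (F : fieldType)
    (f : {rmorphism R -> F}) (g : {rmorphism R' -> F}) x :
  (forall r, f r \in imfrac g) -> x \in imfrac f -> x \in imfrac g.
Proof. by move=> fg /imfracP[p [q [_ ->]]]; rewrite rpred_div. Qed.

(** Transitivity of integrality, with the intermediate ring given by the values
    of a morphism: the coefficients of an equation over [R] are themselves
    integral over [R']. *)
Lemma integral_trans (R R' : comNzRingType) (F : fieldType)
    (f : {rmorphism R -> F}) (g : {rmorphism R' -> F}) x :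
  (forall r, integralOver g (f r)) -> integralOver f x -> integralOver g x.
Proof.
move=> fg [p pm px]; apply: integral_root_monic (monic_map f pm) px _.
by apply/integral_poly => i; rewrite coef_map; apply: fg.
Qed.

Lemma algebraic_trans (K K' F : fieldType)
    (f : {rmorphism K -> F}) (g : {rmorphism K' -> F}) x :
  (forall r, algebraicOver g (f r)) -> algebraicOver f x -> algebraicOver g x.
Proof.
move=> fg /integral_algebraic fx; apply/integral_algebraic.
by apply: integral_trans fx => r; apply/integral_algebraic.
Qed.

Lemma algebraic_sub_range (K K' F : fieldType)
    (f : {rmorphism K -> F}) (g : {rmorphism K' -> F}) x :
  (forall r, exists r', f r = g r') -> algebraicOver f x -> algebraicOver g x.
Proof.
by move=> fg; apply: algebraic_trans => r; have [r' ->] := fg r; apply: algebraic_id.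
Qed.

Section CommonDenominator.
Variables (R : comNzRingType) (F : fieldType) (f : {rmorphism R -> F}).

(** Lets an equation over the fraction field be replaced by one over the ring. *)
Lemma imfrac_common n (x : 'I_n -> F) : (forall i, x i \in imfrac f) ->
  exists d (p : 'I_n -> R), f d != 0 /\ forall i, f d * x i = f (p i).
Proof.
move=> xf.
have /choice[p /choice[q pq]] : forall i, exists p q, f q != 0 /\ x i = f p / f q.
  by move=> i; exact/imfracP.
exists (\prod_i q i), (fun i => p i * \prod_(j | j != i) q j); split.
  by rewrite rmorph_prod; apply/prodf_neq0 => i _; case: (pq i).
move=> i; have [qi xi] := pq i.
by rewrite (bigD1 i) //= !rmorphM /= xi mulrC mulrA divfK.
Qed.

(** Clearing denominators.  The condition on [q] bears on its image because [f]
    need not be injective. *)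
Lemma algebraic_imfrac x : algebraicOver (imemb (f:=f)) x <->
  exists2 q : {poly R}, map_poly f q != 0 & root (map_poly f q) x.
Proof.
split=> [[p p0 px]|[q q0 qx]]; last first.
  exists (map_poly (to_imfield f) q).
    by rewrite -(map_poly_eq0 (imemb (f:=f))) -map_poly_comp.
  by rewrite -map_poly_comp.
have [d [r [d0 rE]]] := imfrac_common (fun i : 'I_(size p) => imvalP p`_i).
have qE : map_poly f (\poly_(i < size p) oapp r 0 (insub i)) =
    f d *: map_poly (imemb (f:=f)) p.
  apply/polyP => i; rewrite coef_map coef_poly coefZ coef_map /=.
  case: ltnP => [ip|ip]; first by rewrite insubT /= -rE.
  by rewrite rmorph0 nth_default // mulr0.
exists (\poly_(i < size p) oapp r 0 (insub i)); rewrite qE.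
  by rewrite scaler_eq0 negb_or d0 map_poly_eq0.
by rewrite rootZ.
Qed.
End CommonDenominator.

(** A relation G(x, y) = 0 can be read as an equation for y over E(x) or, after
    swapping the variables, as one for x over E(y); the latter is not trivial
    because y is transcendental over E. *)
Lemma exchange (E F : fieldType) (e : {rmorphism E -> F}) x y :
  algebraicOver (imemb (f := eval_at e x)) y -> ~ algebraicOver e y ->
  algebraicOver (imemb (f := eval_at e y)) x.
Proof.
move=> /algebraic_imfrac[q q0 qy] ny.
apply/algebraic_imfrac; exists (swapXY q).
  apply: contra_neq q0 => /polyP sq0; apply/polyP => i; rewrite coef_map coef0.
  have -> : q = 0; last by rewrite coef0 raddf0.
  rewrite -[q]swapXYK; apply/eqP; rewrite swapXY_eq0; apply/eqP/polyP => j.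
  rewrite coef0; apply/eqP/contraT => qj; case: ny; exists (swapXY q)`_j => //.
  by have /eqP := sq0 j; rewrite coef_map coef0 /= eval_atE.
have evE (p : {poly {poly E}}) u v :
    (map_poly (eval_at e u) p).[v] = (map_poly (map_poly e) p).[v%:P].[u].
  rewrite -[RHS]/(horner_eval u _) -horner_map -[X in _ = _.[X]]/(v%:P.[u]) hornerC.
  by congr (_.[_]); apply/polyP => i; rewrite !coef_map /=.
move: qy; rewrite /root !evE -swapXY_map.
by rewrite -[_.[_].[_]]/(_.[_, _]) -[X in _ -> X == 0]/(_.[_, _]) horner2_swapXY.
Qed.

Definition lin_dep (E F : fieldType) (e : E -> F) n (y : 'I_n -> F) :=
  exists2 c : 'I_n -> E, (exists i, c i != 0) & \sum_i e (c i) * y i = 0.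

(** More vectors than generators: the coordinate matrix has a nonzero left kernel. *)
Lemma finite_lin_dep (E F : fieldType) (e : {rmorphism E -> F}) :
  finite_extension e -> exists m, forall y : 'I_m.+1 -> F, lin_dep e y.
Proof.
move=> [m [b /choice[cc bE]]]; exists m => y.
pose A := \matrix_(i < m.+1, j < m) cc (y i) j.
have : kermx A != 0.
  rewrite kermx_eq0 /row_free; apply: contraTneq (rank_leq_col A) => ->.
  by rewrite ltnn.
case/rowV0Pn => v /sub_kermxP vA v0; exists (v 0).
  apply/existsP; apply: contraNT v0 => /existsPn vz; apply/eqP/rowP => i.
  by rewrite mxE; apply/eqP; move: (vz i); rewrite negbK.
transitivity (\sum_i \sum_j e (v 0 i * A i j) * b j).
  apply: eq_bigr => i _; rewrite [y i]bE mulr_sumr.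
  by apply: eq_bigr => j _; rewrite mulrA rmorphM mxE.
rewrite exchange_big big1 //= => j _.
rewrite -mulr_suml -rmorph_sum.
by have /rowP/(_ j) := vA; rewrite !mxE => ->; rewrite rmorph0 mul0r.
Qed.

Lemma finite_algebraic (E F : fieldType) (e : {rmorphism E -> F}) :
  finite_extension e -> forall x, algebraicOver e x.
Proof.
move=> /finite_lin_dep[m dep] x.
have [c [i ci] cx] := dep (fun i => x ^+ i).
exists (\poly_(i < m.+1) c (inord i)).
  apply: contra_neq ci => /polyP/(_ i); rewrite coef_poly ltn_ord inord_val.
  by rewrite coef0.
rewrite rootE (@horner_coef_wide _ m.+1); last first.
  by rewrite size_map_poly size_poly.
apply/eqP; rewrite -[RHS]cx; apply: eq_bigr => j _.
by rewrite coef_map coef_poly ltn_ord inord_val.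
Qed.

(** A maximal independent family spans.  This is how residue fields are shown to
    be finite: relations can be pushed to a residue field, generators cannot. *)
Lemma lin_dep_finite (E F : fieldType) (e : {rmorphism E -> F}) m :
  (forall y : 'I_m.+1 -> F, lin_dep e y) -> finite_extension e.
Proof.
elim: m => [|m IH] dep.
  exists 0, (fun=> 0) => x; exists (fun=> 0); rewrite big_ord0.
  have [c [i ci]] := dep (fun=> x); rewrite big_ord1 => /eqP.
  by rewrite mulf_eq0 fmorph_eq0; move: ci; rewrite ord1 => /negPf -> /eqP.
have [dep'|/existsNP[y ind]] := pselect (forall y : 'I_m.+1 -> F, lin_dep e y).
  exact: IH.
exists m.+1, y => x.
have [c [i ci]] := dep (fun i => oapp y x (unlift ord0 i)).
rewrite big_ord_recl unlift_none /= => cE.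
have c0 : c ord0 != 0.
  apply: contra_notN ind => /eqP c0; exists (fun i => c (lift ord0 i)).
    move: ci; case: (unliftP ord0 i) => [j ->|->]; first by exists j.
    by rewrite c0 eqxx.
  rewrite -[RHS]cE c0 rmorph0 mul0r add0r.
  by apply: eq_bigr => j _; rewrite liftK.
exists (fun j => - (c ord0)^-1 * c (lift ord0 j)).
apply: (@mulfI _ (e (c ord0))); first by rewrite fmorph_eq0.
apply/eqP; rewrite -subr_eq0 -[X in _ == X]cE; apply/eqP; congr (_ + _).
rewrite mulr_sumr -sumrN; apply: eq_bigr => j _; rewrite liftK /= rmorphM rmorphN.
by rewrite fmorphV !mulNr mulrN opprK !mulrA divff ?fmorph_eq0 // mul1r.
Qed.

(** * Finitely generated algebraic extensions *)

(** If 1/y satisfies a monic equation of degree d + 1 over a ring containing y,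
    multiplying it by y^d expresses 1/y as a polynomial in y.  This one fact gives
    that valuation rings are integrally closed, that algebraic ring extensions of
    a field are fields, and that 1/y is not integral over E[y] for y
    transcendental. *)
Lemma integral_inv_in (R : comNzRingType) (F : fieldType) (f : {rmorphism R -> F})
    (S : subringClosed F) y :
  (forall r, f r \in S) -> y \in S -> integralOver f y^-1 -> y^-1 \in S.
Proof.
move=> fS yS [p pm]; rewrite rootE horner_coef.
have [->|y0] := eqVneq y 0; first by rewrite invr0 rpred0.
have [d sp] : exists d, size (map_poly f p) = d.+1.
  by exists (size (map_poly f p)).-1; rewrite prednK // size_poly_gt0 monic_neq0 ?monic_map.
rewrite sp big_ord_recr /= -[X in _`_X]/(d.+1.-1) -sp -lead_coefE.
rewrite (eqP (monic_map f pm)) mul1r; case: d sp => [|d] sp.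
  by rewrite big_ord0 add0r expr0 oner_eq0.
rewrite addrC addr_eq0 => /eqP yd.
have -> : y^-1 = y ^+ d * y^-1 ^+ d.+1.
  by rewrite exprSr mulrA -exprMn divff // expr1n mul1r.
rewrite yd mulrN rpredN mulr_sumr rpred_sum // => i _.
rewrite coef_map mulrCA rpredM ?fS // exprVn.
have id : (i <= d)%N by rewrite -ltnS.
have -> : y ^+ d = y ^+ (d - i) * y ^+ i by rewrite -exprD subnK.
by rewrite mulfK ?expf_neq0 ?rpredX.
Qed.

Section Span.
Variables (E F : fieldType) (e : {rmorphism E -> F}).

Definition spanned (I : finType) (b : I -> F) (x : F) :=
  exists c : I -> E, x = \sum_i e (c i) * b i.

Variables (I : finType) (b : I -> F).

Lemma spanned0 : spanned b 0.
Proof. by exists (fun=> 0); rewrite big1 // => i; rewrite rmorph0 mul0r. Qed.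

Lemma spannedD x y : spanned b x -> spanned b y -> spanned b (x + y).
Proof.
move=> [c ->] [d ->]; exists (fun i => c i + d i); rewrite -big_split.
by apply: eq_bigr => i _; rewrite rmorphD mulrDl.
Qed.

Lemma spannedZ a x : spanned b x -> spanned b (e a * x).
Proof.
move=> [c ->]; exists (fun i => a * c i); rewrite mulr_sumr.
by apply: eq_bigr => i _; rewrite rmorphM mulrA.
Qed.

Lemma spanned_id i : spanned b (b i).
Proof.
exists (fun j => (j == i)%:R); rewrite (bigD1 i) //= eqxx rmorph1 mul1r.
by rewrite big1 ?addr0 // => j /negPf ->; rewrite rmorph0 mul0r.
Qed.

Lemma spanned_sum (J : finType) (P : pred J) (x : J -> F) :
  (forall j, P j -> spanned b (x j)) -> spanned b (\sum_(j | P j) x j).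
Proof. by apply: big_ind; [exact: spanned0|exact: spannedD]. Qed.
End Span.

(** Adjoining the generators one at a time keeps a ring that is finitely spanned,
    since powers of an algebraic element reduce below its degree; the ring reached
    at the end is algebraic over [E], hence a field, hence all of [F]. *)
Lemma fg_algebraic_finite (E F : fieldType) (e : {rmorphism E -> F}) :
  finitely_generated_field e -> (forall x, algebraicOver e x) ->
  finite_extension e.
Proof.
move=> [s gs] alg.
have [I [b [b1 bM bs]]] : exists (I : finType) (b : I -> F),
   [/\ spanned e b 1, forall x y, spanned e b x -> spanned e b y -> spanned e b (x * y)
     & forall x, x \in s -> spanned e b x].
  (* the products b_i x^j, with j below the degree of x, span the next ring *)
  elim: s {gs} => [|x s [I [b [b1 bM bs]]]].
    have V a : spanned e (fun _ : unit => 1) (e a).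
      by rewrite -[e a]mulr1; apply/spannedZ/(@spanned_id _ _ _ _ _ tt).
    exists unit, (fun=> 1); split => //; first by have := V 1; rewrite rmorph1.
    move=> _ _ [c ->] [d ->].
    by rewrite -!mulr_suml !mulr1 -!rmorph_sum -rmorphM; apply: V.
  have /integral_algebraic[p pm] := alg x.
  rewrite rootE horner_coef.
  have [d sp] : exists d, size (map_poly e p) = d.+1.
    by exists (size (map_poly e p)).-1; rewrite prednK // size_poly_gt0 monic_neq0 ?monic_map.
  rewrite sp big_ord_recr /= -[X in _`_X]/(d.+1.-1) -sp -lead_coefE.
  rewrite (eqP (monic_map e pm)) mul1r addrC addr_eq0 => /eqP xd.
  pose b' (ij : I * 'I_d) := b ij.1 * x ^+ ij.2.
  have V'E (y : F) : spanned e b y -> forall j : 'I_d, spanned e b' (y * x ^+ j).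
    move=> [c ->] j; rewrite mulr_suml; apply: spanned_sum => i _.
    by rewrite -mulrA; apply/spannedZ/(spanned_id e b' (i, j)).
  have Vx (y : F) : spanned e b y -> forall j, (j <= d)%N -> spanned e b' (y * x ^+ j).
    move=> Vy j; rewrite leq_eqVlt => /predU1P[->|jd]; last exact: (V'E y Vy (Ordinal jd)).
    rewrite xd mulrN -mulNr mulr_sumr; apply: spanned_sum => i _.
    rewrite coef_map /= mulrCA; apply/spannedZ/V'E.
    by rewrite -mulN1r -(rmorph1 e) -rmorphN; apply: spannedZ.
  have Mx (z : F) : spanned e b' z -> spanned e b' (z * x).
    move=> [c ->]; rewrite mulr_suml; apply: spanned_sum => -[i j] _ /=.
    rewrite -mulrA; apply: spannedZ; rewrite /b' /= -mulrA -exprSr.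
    by apply: Vx => //; exact: spanned_id.
  have MV (y z : F) : spanned e b y -> spanned e b' z -> spanned e b' (y * z).
    move=> Vy [c ->]; rewrite mulr_sumr; apply: spanned_sum => -[i j] _ /=.
    rewrite mulrCA; apply: spannedZ; rewrite mulrA; apply: V'E.
    by apply: bM => //; exact: spanned_id.
  have V1 (y : F) : spanned e b y -> spanned e b' y.
    by move=> Vy; rewrite -[y]mulr1 -(expr0 x); apply: Vx.
  exists (I * 'I_d)%type, b'; split; first exact: V1.
    move=> y z [c ->] Vz; rewrite mulr_suml; apply: spanned_sum => -[i j] _ /=.
    rewrite -mulrA; apply: spannedZ; rewrite /b' /= -mulrA; apply: MV.
      exact: spanned_id.
    rewrite mulrC; elim: (nat_of_ord j) => [|k IH]; first by rewrite mulr1.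
    by rewrite exprSr mulrA; apply: Mx.
  move=> y; rewrite inE => /predU1P[->|ys]; last exact/V1/bs.
  by rewrite -[x]mul1r; apply/Mx/V1.
pose V : {pred F} := [pred x | `[< spanned e b x >]].
have VP x : x \in V <-> spanned e b x by split=> /asboolP.
have eV a : e a \in V by apply/VP; rewrite -[e a]mulr1; apply: spannedZ.
have Vcl : subring_closed V.
  split=> [|x y /VP Vx /VP Vy|x y /VP Vx /VP Vy]; apply/VP => //; last exact: bM.
  apply: spannedD => //; rewrite -mulN1r -(rmorph1 e) -rmorphN.
  exact: spannedZ.
have Vdiv : divring_closed V.
  have [V1 VB VM] := Vcl; split=> // x y Vx Vy; apply: VM => //.
  pose V' : subringClosed F := HB.pack V (GRing.isSubringClosed.Build F V Vcl).
  by apply: (@integral_inv_in _ _ e V' _ eV) => //; apply/integral_algebraic/alg.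
have VT x : spanned e b x.
  by apply/VP/(gs V Vdiv) => // y /bs ?; apply/VP.
exists #|I|, (fun k => b (enum_val k)) => x.
have [c ->] := VT x; exists (fun k => c (enum_val k)).
by rewrite -(big_enum_val (fun i => e (c i) * b i)).
Qed.

(** * The place of a valuation ring *)

Section ValuationSubring.
Variables (F : fieldType) (V : subringClosed F).

Record vring := VRing { vring_val : F; vring_valP : vring_val \in V }.
HB.instance Definition _ := [isSub for vring_val].
HB.instance Definition _ := [Choice of vring by <:].
HB.instance Definition _ := [SubChoice_isSubComNzRing of vring by <:].

(** The maximal ideal of [V]. *)
Definition nonunits : {pred vring} :=
  [pred x | (val x == 0) || ((val x)^-1 \notin V)].

Hypothesis Vval : forall x, x \notin V -> x^-1 \in V.

(** For a sum x + y, one of x / y and y / x lies in [V]; so x + y is a multiple in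
    [V] of y or of x, and a multiple of a nonunit is a nonunit. *)
Lemma nonunits_ideal : idealr_closed nonunits.
Proof.
have mulV (a x : F) : a \in V -> a * x != 0 -> x^-1 \notin V -> (a * x)^-1 \notin V.
  move=> aV; rewrite mulf_eq0 negb_or => /andP[a0 x0]; apply: contra => axV.
  have -> : x^-1 = a * (a * x)^-1 by rewrite invfM mulrA divff // mul1r.
  exact: rpredM.
have addV x y : x \in V -> y \in V -> x + y != 0 -> x != 0 -> y != 0 ->
    x / y \in V -> y^-1 \notin V -> (x + y)^-1 \notin V.
  move=> xV yV xy0 x0 y0 xyV yV'.
  have xyE : x + y = (x / y + 1) * y by rewrite mulrDl divfK // mul1r.
  rewrite xyE; apply: mulV => //; first by rewrite rpredD ?rpred1.
  by rewrite -xyE.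
have M (a x : vring) : x \in nonunits -> a * x \in nonunits.
  rewrite !inE /= => /orP[/eqP->|xV]; first by rewrite mulr0 eqxx.
  by have [->//|ax0] := eqVneq (val a * val x) 0; apply: mulV => //; exact: valP.
split=> [||a x y xN yN]; first by rewrite inE eqxx.
  by rewrite inE /= oner_eq0 invr1 rpred1.
have {xN} := M a _ xN; move: (a * x) => {}x xN; move: xN yN; rewrite !inE /=.
have [-> _|x0 /= xV] := eqVneq (vring_val x) 0; first by rewrite add0r.
have [-> _|y0 /= yV] := eqVneq (vring_val y) 0.
  by rewrite addr0 (negPf x0).
have [//|xy0] /= := eqVneq (val x + val y) 0.
have [xyV|/Vval] := boolP (val x / val y \in V).
  exact: (addV _ _ (valP x) (valP y)).
rewrite invf_div => yxV; rewrite addrC; apply: (addV _ _ (valP y) (valP x)) => //.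
by rewrite addrC.
Qed.

Let I : idealr vring := HB.pack nonunits (isIdealr.Build vring nonunits nonunits_ideal).
Let Q : comNzRingType := {ideal_quot I}.
Let pi : {rmorphism vring -> Q} := \pi_{ideal_quot I}%qT.

Let piE x y : (pi x == pi y) = (x - y \in nonunits).
Proof. exact: esym (Quotient.idealrBE I x y). Qed.

Let pi_repr (q : Q) : pi (repr q) = q. Proof. exact: reprK. Qed.

Let repr_eq0 (q : Q) : (repr q \in nonunits) = (q == 0).
Proof. by rewrite -[X in X \in _]subr0 -piE pi_repr rmorph0. Qed.

Let qinv (q : Q) : Q :=
  let x := repr q in if x \in nonunits then 0 else pi (insubd 0 (val x)^-1).

Let qmulVf q : q != 0 -> qinv q * q = 1.
Proof.
rewrite -repr_eq0 /qinv => qN; rewrite (negPf qN) -[X in _ * X]pi_repr.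
rewrite -rmorphM -[RHS](rmorph1 pi); congr (pi _); apply: val_inj.
move: qN; rewrite inE negb_or negbK => /andP[q0 qV] /=.
by rewrite -[vring_val (insubd _ _)]/(val _) val_insubd qV mulVf.
Qed.

Let qinv0 : qinv 0 = 0.
Proof. by rewrite /qinv ifT // repr_eq0. Qed.

(** The quotient by the nonunits is a field: a class outside the ideal is inverted
    through any representative. *)
Lemma residue_field_exists : exists (k : fieldType) (res : {rmorphism vring -> k}),
  (forall a, exists v, res v = a) /\ forall v, (res v == 0) = (v \in nonunits).
Proof.
pose Qf : fieldType := HB.pack Q (GRing.ComNzRing_isField.Build Q qmulVf qinv0).
exists Qf, pi; split=> [a|v]; first by exists (repr (a : Q)); apply: pi_repr.
by rewrite -[v in RHS]subr0 -piE rmorph0.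
Qed.

End ValuationSubring.

Section PlaceOfValuationRing.
Variables (K F : fieldType) (iota : {rmorphism K -> F}).
Variable V : subringClosed F.
Hypothesis Vval : forall x, x \notin V -> x^-1 \in V.
Hypothesis iotaV : forall c, iota c \in V.

Lemma place_of_valuation_ring :
  exists P : place iota, forall x, (P x != None) = (x \in V).
Proof.
have [k [res [res_surj res0]]] := residue_field_exists Vval.
pose emb (c : K) : k := res (VRing (iotaV c)).
have embB : zmod_morphism emb.
  by move=> x y; rewrite -rmorphB; congr (res _); apply: val_inj; rewrite /= rmorphB.
have embM : monoid_morphism emb.
  split=> [|x y]; last by rewrite -rmorphM; congr (res _); apply: val_inj; rewrite /= rmorphM.
  by rewrite -(rmorph1 res); congr (res _); apply: val_inj; rewrite /= rmorph1.
pose kmor : {rmorphism K -> k} := HB.pack emb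
  (GRing.isZmodMorphism.Build _ _ emb embB) (GRing.isMonoidMorphism.Build _ _ emb embM).
pose pl (x : F) : option k := omap res (insub x).
have plE x a : pl x = Some a -> exists2 v : vring V, val v = x & a = res v.
  by rewrite /pl; case: insubP => //= v _ vx [<-]; exists v.
have plV (v : vring V) : pl (val v) = Some (res v) by rewrite /pl valK.
have plK c : pl (iota c) = Some (kmor c) by exact: (plV (VRing (iotaV c))).
have plD x y a b : pl x = Some a -> pl y = Some b -> pl (x + y) = Some (a + b).
  move=> /plE[v <- ->] /plE[w <- ->].
  by rewrite -raddfD plV raddfD.
have plM x y a b : pl x = Some a -> pl y = Some b -> pl (x * y) = Some (a * b).
  move=> /plE[v <- ->] /plE[w <- ->].
  by have := plV (v * w); rewrite rmorphM rmorphM.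
have pli x : pl x = None -> pl x^-1 = Some 0.
  move=> px; have xV : x \notin V.
    by apply/negP => xV; move: px; rewrite -[x]/(val (VRing xV)) plV.
  rewrite -[x^-1]/(val (VRing (Vval xV))) plV; congr Some; apply/eqP.
  by rewrite res0 inE /= invrK xV orbT.
have pls a : exists x, pl x = Some a.
  by have [v <-] := res_surj a; exists (val v); rewrite plV.
exists (Place plK plD plM pli pls) => x /=; rewrite /pl.
by case: insubP => [v -> _|/negPf ->].
Qed.
End PlaceOfValuationRing.

(** * Chevalley's theorem *)

Section MaximalSubring.
Variables (F : fieldType) (A : subringClosed F) (u : F).
Hypotheses (uA : u \notin A) (uVA : u^-1 \in A).
(* Proper overrings of A contain u; it is enough to know it of the A[x]. *)
Hypothesis maxA : forall x, x \notin A ->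
  exists2 q : {poly F}, q \is a polyOver A & u = q.[x].

Let u0 : u != 0.
Proof. by apply: contraNneq uA => ->; rewrite rpred0. Qed.

(* The ideal of A generated by the nonunit 1/u; it takes the place of the maximal
   ideal, which is not known at this stage. *)
Let J : {pred F} := [pred x | u * x \in A].

Let JD x y : x \in J -> y \in J -> x + y \in J.
Proof. by rewrite !inE mulrDr; apply: rpredD. Qed.
Let JM x a : x \in J -> a \in A -> x * a \in J.
Proof. by rewrite !inE mulrA; apply: rpredM. Qed.
Let JA x : x \in J -> x \in A.
Proof. by rewrite inE => ux; rewrite -[x](mulKf u0) rpredM. Qed.
Let J1 : 1 \notin J.
Proof. by rewrite inE mulr1. Qed.
Let J0 : 0 \in J.
Proof. by rewrite inE mulr0 rpred0. Qed.

(** If A did not contain w = 1 / (1 - r), then A[w] would contain u; clearing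
    denominators puts a power of 1 - r, hence 1, in the ideal generated by 1/u. *)
Lemma sub1_unit r : r \in J -> (1 - r)^-1 \in A.
Proof.
move=> rJ; have r1 : 1 - r != 0.
  by apply: contraNneq J1 => /subr0_eq ->.
have rA : 1 - r \in A by rewrite rpredB ?rpred1 ?JA.
apply/contraT => /maxA[q qA uq].
have : (1 - r) ^+ size q \in J.
  rewrite inE {1}uq horner_coef mulr_suml rpred_sum // => i _.
  rewrite -mulrA rpredM ?(polyOverP qA) // exprVn.
  have -> : (1 - r) ^+ size q = (1 - r) ^+ i * (1 - r) ^+ (size q - i).
    by rewrite -exprD subnKC // ltnW.
  by rewrite mulKf ?rpredX // expf_neq0.
have rX k : 1 - (1 - r) ^+ k \in J.
  elim: k => [|k IH]; first by rewrite expr0 subrr.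
  have -> : 1 - (1 - r) ^+ k.+1 = (1 - (1 - r) ^+ k) + r * (1 - r) ^+ k.
    by rewrite exprS; ring.
  by rewrite JD // JM // rpredX.
move=> qJ; have := JD qJ (rX (size q)).
by rewrite addrCA subrr addr0 (negPf J1).
Qed.

(* y witnesses that J generates the unit ideal in A[y], in degree below n. *)
Let unit_eq (y : F) n := exists q : {poly F},
  [/\ (size q <= n)%N, forall i, q`_i \in J & q.[y] = 1].

Let unit_eq_notin x : x \notin A -> exists n, unit_eq x n.
Proof.
move=> /maxA[q qA uq]; exists (size (u^-1 *: q)), (u^-1 *: q); split=> // [i|].
  by rewrite inE coefZ mulrA divff // mul1r (polyOverP qA).
by rewrite hornerZ -uq mulVf.
Qed.

(* A relation for 1/y has an invertible coefficient 1 - r_0 at 1; dividing by it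
   and multiplying by y^n rewrites the top power of y in the relation for y. *)
Let unit_eq_reduce y n m : y != 0 -> unit_eq y n -> unit_eq y^-1 m -> (m <= n)%N ->
  exists2 k, (k < n)%N & unit_eq y k.
Proof.
move=> y0 [q [sq qJ q1]] [r [sr rJ r1]] mn.
case: n => [|n] in sq mn *.
  move: q1 sq => + /size_poly_leq0P q0; rewrite q0 horner0 => /eqP.
  by rewrite eq_sym oner_eq0.
exists n => //.
have r0A := sub1_unit (rJ 0).
pose s k := r`_k * (1 - r`_0)^-1.
have sJ k : s k \in J by apply: JM.
exists (\poly_(i < n) (q`_i + q`_n * s (n - i)%N)); split.
- exact: size_poly.
- move=> i; rewrite coef_poly; case: ifP => _ //.
  by rewrite JD // JM // JA.
have sE : \sum_(i < n) s (n - i)%N * y ^+ i = y ^+ n.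
  have r0 : 1 - r`_0 != 0.
    by apply: contraNneq J1 => /subr0_eq ->.
  apply: (mulIf r0); rewrite mulr_suml.
  transitivity (\sum_(i < n) r`_(n - i) * y ^+ i).
    by apply: eq_bigr => i _; rewrite /s mulrAC divfK.
  move: r1; rewrite (@horner_coef_wide _ n.+1) ?(leq_trans sr) //.
  rewrite big_ord_recl expr0 mulr1 addrC => /(canRL (addrK _)) <-.
  rewrite mulr_sumr (reindex_inj rev_ord_inj) /=.
  apply: eq_bigr => i _; rewrite /bump add1n subKn // mulrCA exprVn.
  congr (_ * _).
  have -> : y ^+ n = y ^+ (n - i.+1) * y ^+ i.+1 by rewrite -exprD subnK.
  by rewrite mulfK ?expf_neq0.
rewrite horner_poly -[RHS]q1 (horner_coef_wide _ sq) big_ord_recr /= -sE.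
rewrite mulr_sumr -big_split /=; apply: eq_bigr => i _.
by rewrite mulrDl mulrA.
Qed.

(** If neither x nor 1/x were in A, both would have relations with coefficients in
    the ideal; take both of minimal degree and shorten the longer one. *)
Lemma maximal_subring_valuation x : x \notin A -> x^-1 \in A.
Proof.
move=> xA; apply/contraT => xVA.
have x0 : x != 0 by apply: contraNneq xA => ->; rewrite rpred0.
have ex1 : exists n, `[< unit_eq x n >].
  by have [n ?] := unit_eq_notin xA; exists n; apply/asboolP.
have ex2 : exists n, `[< unit_eq x^-1 n >].
  by have [n ?] := unit_eq_notin xVA; exists n; apply/asboolP.
case: (ex_minnP ex1) => n /asboolP xn nmin.
case: (ex_minnP ex2) => m /asboolP xm mmin.
have [mn|/ltnW nm] := leqP m n.
  have [k kn /asboolP /nmin] := unit_eq_reduce x0 xn xm mn.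
  by rewrite leqNgt kn.
have := @unit_eq_reduce x^-1 m n.
rewrite invr_eq0 invrK => /(_ x0 xm xn nm)[k km /asboolP /mmin].
by rewrite leqNgt km.
Qed.
End MaximalSubring.

Section Chevalley.
Variables (R : comNzRingType) (F : fieldType) (f : {rmorphism R -> F}) (u : F).
Hypothesis uNint : ~ integralOver f u.

Local Open Scope classical_set_scope.

(** The poset to which Zorn's lemma is applied.  In such a ring 1/u is a nonunit,
    and this is what forces maximal elements to be valuation rings. *)
Definition avoiding_subring (A : set F) :=
  [/\ forall x y, A x -> A y -> A (x - y), forall x y, A x -> A y -> A (x * y),
      forall r, A (f r), A u^-1 & ~ A u].

(** The ring generated by 1/u over the image of [f] works: u = p(1/u) would give,
    after multiplication by a power of u, a monic equation for u. *)
Lemma avoiding_subring_exists : exists A, avoiding_subring A.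
Proof.
exists [set x | exists p, x = eval_at f u^-1 p]; split.
- by move=> _ _ [p ->] [q ->]; exists (p - q); rewrite rmorphB.
- by move=> _ _ [p ->] [q ->]; exists (p * q); rewrite rmorphM.
- by move=> r; exists r%:P; rewrite eval_atC.
- by exists 'X; rewrite eval_atX.
move=> [p pE]; apply: uNint.
have [u0|u0] := eqVneq u 0; first by rewrite u0 -(rmorph0 f); apply: integral_id.
pose n := size p.
exists ('X^n - \poly_(i < n) p`_(n - i.+1)).
  rewrite monicE lead_coefDl ?lead_coefXn // size_polyXn size_polyN.
  by rewrite ltnS size_poly.
rewrite rootE rmorphB /= map_polyXn hornerD hornerN hornerXn subr_eq0.
have -> : map_poly f (\poly_(i < n) p`_(n - i.+1)) =
    \poly_(i < n) f p`_(n - i.+1).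
  by apply/polyP => i; rewrite coef_map !coef_poly /=; case: ifP => _; rewrite ?raddf0.
rewrite horner_poly (reindex_inj rev_ord_inj) /=.
have n0 : (0 < n)%N.
  rewrite size_poly_gt0; apply: contra_neq u0 => p0.
  by rewrite pE p0 rmorph0.
have -> : u ^+ n = u ^+ n.-1 * u by rewrite -exprSr prednK.
rewrite {2}pE eval_atE (@horner_coef_wide _ n) ?size_map_poly ?size_poly //.
rewrite mulr_sumr; apply/eqP/eq_bigr => i _.
rewrite coef_map mulrCA exprVn subnSK // subKn 1?ltnW //; congr (_ * _).
have -> : u ^+ n.-1 = u ^+ (n - i.+1) * u ^+ i.
  have nE k : (k < n)%N -> n.-1 = (n - k.+1 + k)%N.
    by move=> kn; rewrite -{1}(subnKC kn) addSn addnC.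
  by rewrite -exprD -nE.
by rewrite mulfK // expf_neq0.
Qed.

Lemma avoiding_subring_maximal : exists A, avoiding_subring A /\
  forall B, A `<=` B -> avoiding_subring B -> B = A.
Proof.
have [A0 A0P] := avoiding_subring_exists.
(* the empty set is admitted because it is the union of the empty chain *)
have [|A [AP Amax]] := @Zorn_bigcup F [set A | A = set0 \/ avoiding_subring A].
  move=> C CP Ctot.
  have [[A [CA AP]]|nA] := pselect (exists A, C A /\ avoiding_subring A); last first.
    left; apply/seteqP; split=> // x [A CA Ax].
    have [A0'|AP] := CP _ CA; first by rewrite A0' in Ax.
    by case: nA; exists A.
  have join x y : (\bigcup_(X in C) X) x -> (\bigcup_(X in C) X) y ->
      exists B, [/\ C B, avoiding_subring B, B x & B y].
    move=> [X CX Xx] [Y CY Yy].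
    have PX : avoiding_subring X by have [X0|//] := CP _ CX; rewrite X0 in Xx.
    have PY : avoiding_subring Y by have [Y0|//] := CP _ CY; rewrite Y0 in Yy.
    by have [XY|YX] := Ctot _ _ CX CY; [exists Y|exists X]; split; auto.
  right; split.
  - by move=> x y /join h/h[B [CB [BB _ _ _ _] Bx By]]; exists B; auto.
  - by move=> x y /join h/h[B [CB [_ BM _ _ _] Bx By]]; exists B; auto.
  - by move=> r; case: AP => _ _ Ar _ _; exists A.
  - by case: AP => _ _ _ Au _; exists A.
  by move=> ux; have [B [_ [_ _ _ _ Bu] ? _]] := join _ _ ux ux.
have AP' : avoiding_subring A.
  case: AP => // A0'; case: (Amax A0); last by right.
  case: A0P => _ _ _ Au _; rewrite A0'; split=> // /(_ _ Au) //.
exists A; split=> // B AB BP; apply: contrapT => BA.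
by apply: (Amax B); [split=> // BA'; apply/BA/seteqP|right].
Qed.

Lemma valuation_ring_avoiding : exists V : subringClosed F,
  [/\ forall x, x \notin V -> x^-1 \in V, forall r, f r \in V & u \notin V].
Proof.
have [A [[AB AM Af AuV Au] Amax]] := avoiding_subring_maximal.
pose Ap : {pred F} := [pred x | `[< A x >]].
have ApP x : x \in Ap <-> A x by split=> /asboolP.
have A1 : A 1 by rewrite -(rmorph1 f).
have Acl : subring_closed Ap.
  split=> [|x y /ApP Ax /ApP Ay|x y /ApP Ax /ApP Ay]; apply/ApP => //.
    exact: AB.
  exact: AM.
pose V : subringClosed F := HB.pack Ap (GRing.isSubringClosed.Build F Ap Acl).
have uV : u \notin V by apply/negP => /ApP.
exists V; split=> // [|r]; last exact/ApP.
apply: (maximal_subring_valuation uV); first exact/ApP.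
move=> x xV.
pose B := [set y | exists2 q : {poly F}, q \is a polyOver V & y = q.[x]].
have AsubB : A `<=` B.
  by move=> y Ay; exists y%:P; rewrite ?hornerC // polyOverC; apply/ApP.
apply: contrapT => uB; move/negP: xV; apply; apply/ApP.
rewrite -(Amax B) //; first by exists 'X; rewrite ?hornerX ?polyOverX.
split=> //.
- by move=> _ _ [p pV ->] [q qV ->]; exists (p - q); rewrite ?rpredB ?hornerD ?hornerN.
- by move=> _ _ [p pV ->] [q qV ->]; exists (p * q); rewrite ?rpredM ?hornerM.
- by move=> r; apply: AsubB.
- exact: AsubB.
Qed.
End Chevalley.

(** Chevalley's theorem in the form used below: integral closures are intersections
    of valuation rings, so non-integrality of [u] is witnessed by a place with a
    pole at [u].  The first hypothesis makes the place trivial on [K]. *)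
Lemma chevalley (K : fieldType) (R : comNzRingType) (F : fieldType)
    (iota : {rmorphism K -> F}) (f : {rmorphism R -> F}) u :
  (forall c, exists r, iota c = f r) -> ~ integralOver f u ->
  exists P : place iota, (forall r, P (f r) != None) /\ P u = None.
Proof.
move=> iotaf /valuation_ring_avoiding[V [Vval fV uV]].
have [|P PV] := @place_of_valuation_ring _ _ iota V Vval.
  by move=> c; have [r ->] := iotaf c.
exists P; split=> [r|]; first by rewrite PV.
by apply/eqP; rewrite -[_ == _]negbK PV.
Qed.

(** * Gauss's lemma and composition of places *)

Section PlaceRing.
Variables (K F : fieldType) (iota : {rmorphism K -> F}) (P : place iota).

Definition place_ring : {pred F} := [pred x | P x != None].

Lemma place_ringP x : reflect (exists a, P x = Some a) (x \in place_ring).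
Proof.
rewrite inE; case: (P x) => [a|]; constructor; first by exists a.
by case.
Qed.

Lemma place_ring_closed : subring_closed place_ring.
Proof.
split=> [|x y /place_ringP[a Px] /place_ringP[b Py]|x y /place_ringP[a Px] /place_ringP[b Py]];
  apply/place_ringP.
- by exists 1; apply: place1.
- by exists (a - b); apply: placeB.
- by exists (a * b); apply: placeM.
Qed.
HB.instance Definition _ := GRing.isSubringClosed.Build F place_ring place_ring_closed.

Lemma place_ring_iota c : iota c \in place_ring.
Proof. by apply/place_ringP; exists (residue_emb P c); apply: placeK. Qed.

Lemma place_ringV x : x \notin place_ring -> P x^-1 = Some 0.
Proof. by rewrite inE negbK => /eqP; apply: placeV. Qed.

Lemma place_ring_invP x : x \notin place_ring -> x^-1 \in place_ring.
Proof. by move=> /place_ringV Px; apply/place_ringP; exists 0. Qed.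

Lemma place_ring0 x : P x = Some 0 -> x \in place_ring.
Proof. by move=> Px; apply/place_ringP; exists 0. Qed.

Lemma place_inv x a : P x = Some a -> a != 0 -> P x^-1 = Some a^-1.
Proof.
move=> Px a0; have x0 : x != 0.
  by apply: contra_neq a0 => x0; move: Px; rewrite x0 place0 => -[<-].
have [/place_ringP[b Pb]|/place_ringV] := boolP (x^-1 \in place_ring); last first.
  by rewrite invrK Px => -[a00]; rewrite a00 eqxx in a0.
have := placeM Px Pb; rewrite divff // place1 => -[ab]; rewrite Pb; congr Some.
by apply: (mulfI a0); rewrite -ab divff.
Qed.

Lemma place_unit x : x != 0 -> x \in place_ring -> x^-1 \in place_ring ->
  exists2 a, P x = Some a & a != 0.
Proof.
move=> x0 /place_ringP[a Pa] /place_ringP[b Pb]; exists a => //.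
have := placeM Pa Pb; rewrite divff // place1 => -[ab].
by apply: contra_eq_neq ab => ->; rewrite mul0r oner_neq0.
Qed.

Lemma place_sum (I : Type) (r : seq I) (Q : pred I) (x : I -> F) (a : I -> residue P) :
  (forall i, Q i -> P (x i) = Some (a i)) ->
  P (\sum_(i <- r | Q i) x i) = Some (\sum_(i <- r | Q i) a i).
Proof.
move=> xa; elim/big_rec2: _ => [|i b y Qi IH]; first exact: place0.
exact: placeD (xa i Qi) IH.
Qed.

Lemma place_prod (I : Type) (r : seq I) (Q : pred I) (x : I -> F) (a : I -> residue P) :
  (forall i, Q i -> P (x i) = Some (a i)) ->
  P (\prod_(i <- r | Q i) x i) = Some (\prod_(i <- r | Q i) a i).
Proof.
move=> xa; elim/big_rec2: _ => [|i b y Qi IH]; first exact: place1.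
exact: placeM (xa i Qi) IH.
Qed.

Lemma place_exp x a n : P x = Some a -> P (x ^+ n) = Some (a ^+ n).
Proof.
move=> Px; elim: n => [|n IH]; first by rewrite !expr0 place1.
by rewrite !exprS; apply: placeM.
Qed.

Lemma place_expz x a (n : int) : P x = Some a -> a != 0 -> P (x ^ n) = Some (a ^ n).
Proof.
move=> Px a0; case: n => n; first exact: place_exp.
by apply: (@place_inv (x ^+ n.+1) (a ^+ n.+1)); rewrite ?expf_neq0 //; apply: place_exp.
Qed.

Lemma place_integral (R : comNzRingType) (f : {rmorphism R -> F}) x :
  (forall r, f r \in place_ring) -> integralOver f x -> x \in place_ring.
Proof.
move=> fP fx; apply/contraT => xP.
have := integral_inv_in fP (place_ring_invP xP); rewrite invrK => /(_ fx).
by rewrite (negPf xP).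
Qed.

(** An element of largest value in a finite family; dividing by it makes the family
    integral with at least one unit. *)
Lemma place_max (I : finType) (x : I -> F) : (exists i, x i != 0) ->
  exists2 i, x i != 0 & forall j, x j / x i \in place_ring.
Proof.
move=> [i0 xi0].
suff [i xi xmax] : exists2 i, x i != 0 & {in enum I, forall j, x j / x i \in place_ring}.
  by exists i => // j; apply: xmax; rewrite mem_enum.
elim: (enum I) => [|j s [i xi IH]]; first by exists i0.
have [jiP|jiP] := boolP (x j / x i \in place_ring).
  by exists i => // k; rewrite inE => /predU1P[->//|]; apply: IH.
have xj : x j != 0 by apply: contraNneq jiP => ->; rewrite mul0r rpred0.
have ijP := place_ring_invP jiP; rewrite invf_div in ijP.
exists j => // k; rewrite inE => /predU1P[->|/IH kP]; first by rewrite divff ?rpred1.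
have -> : x k / x j = x k / x i * (x i / x j) by rewrite mulrA divfK.
exact: rpredM.
Qed.

Definition residue_poly (p : {poly F}) : {poly residue P} :=
  \poly_(i < size p) odflt 0 (P p`_i).

Lemma coef_residue_poly (p : {poly F}) i :
  p`_i \in place_ring -> P p`_i = Some (residue_poly p)`_i.
Proof.
rewrite coef_poly; case: ltnP => [_|pi]; first by case/place_ringP => a ->.
by rewrite nth_default // place0.
Qed.

(** Gauss's lemma.  Scale both factors to have integral coefficients with a unit
    among them; the residue polynomials are then nonzero, so is their product, and
    the product of the two scaling constants must be integral.  The coefficient 1
    of [f] makes its own constant the inverse of an integral element. *)
Lemma gauss_place (f h : {poly F}) k : (forall i, (f * h)`_i \in place_ring) ->
  f`_k = 1 -> forall i, h`_i \in place_ring.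
Proof.
move=> fhP fk j; have [->|h0] := eqVneq h 0; first by rewrite coef0 rpred0.
have norm (p : {poly F}) : p != 0 -> exists a p1,
    [/\ a != 0, p = a *: p1, forall i, p1`_i \in place_ring & residue_poly p1 != 0].
  move=> p0; have sp : (0 < size p)%N by rewrite size_poly_gt0.
  have lp : ((size p).-1 < size p)%N by rewrite prednK.
  have [|i pi pmax] := @place_max 'I_(size p) (fun i => p`_i).
    by exists (Ordinal lp); rewrite /= -lead_coefE lead_coef_eq0.
  have p1P l : ((p`_i)^-1 *: p)`_l \in place_ring.
    rewrite coefZ mulrC; have [jp|jp] := ltnP l (size p).
      exact: (pmax (Ordinal jp)).
    by rewrite nth_default // mul0r rpred0.
  exists p`_i, ((p`_i)^-1 *: p); split=> //.
    by rewrite scalerA divff // scale1r.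
  apply/eqP => /polyP/(_ i); rewrite coef0 => r0.
  have := coef_residue_poly (p1P i); rewrite coefZ mulVf // place1 r0 => -[/eqP].
  by rewrite oner_eq0.
have f0 : f != 0.
  by apply: contra_eq_neq fk => ->; rewrite coef0 eq_sym oner_neq0.
have [a [f1 [a0 fE f1P rf0]]] := norm _ f0.
have [b [h1 [b0 hE h1P rh0]]] := norm _ h0.
have [i ri] : exists i, (residue_poly f1 * residue_poly h1)`_i != 0.
  have := mulf_neq0 rf0 rh0; rewrite -lead_coef_eq0.
  by set q := _ * _ => lq; exists (size q).-1.
have fh1 : P (f1 * h1)`_i = Some (residue_poly f1 * residue_poly h1)`_i.
  rewrite !coefM; apply: place_sum => l _.
  by apply: placeM; apply: coef_residue_poly.
have u0 : (f1 * h1)`_i != 0.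
  by apply: contraNneq ri => u0; move: fh1; rewrite u0 place0 => -[<-].
have uV : ((f1 * h1)`_i)^-1 \in place_ring.
  by apply/place_ringP; eexists; apply: place_inv fh1 ri.
have abP : a * b \in place_ring.
  have := fhP i; rewrite fE hE -scalerAl -scalerAr scalerA coefZ => abP.
  by rewrite -[a * b](mulfK u0) rpredM.
have aVP : a^-1 \in place_ring.
  have := f1P k; have : a * f1`_k = 1 by rewrite -coefZ -fE.
  by move=> /(canRL (mulKf a0)) ->; rewrite mulr1.
by rewrite hE coefZ rpredM // -[b](mulKf a0) rpredM.
Qed.
End PlaceRing.

(** Gauss's lemma at all places nonnegative on [R] at once.  This replaces the
    argument with conjugates in a splitting field. *)
Lemma factor_integral (K F : fieldType) (iota : {rmorphism K -> F})
    (R : comNzRingType) (g : {rmorphism R -> F}) (f h : {poly F}) k :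
  (forall c, exists r, iota c = g r) ->
  (forall i, integralOver g (f * h)`_i) -> f`_k = 1 ->
  forall i, integralOver g h`_i.
Proof.
move=> iotag fhg fk i; apply: contrapT => /(chevalley iotag)[P [gP Phi]].
have fhP j : (f * h)`_j \in place_ring P by exact: place_integral gP (fhg j).
by have := gauss_place fhP fk i; rewrite inE Phi.
Qed.

Section Composition.
Variables (K E F : fieldType) (iota : {rmorphism K -> F}) (k : {rmorphism K -> E})
  (e : {rmorphism E -> F}).
Hypothesis iotaE : forall c, iota c = e (k c).
Variables (W : place e) (Q : place (residue_emb W \o k)).

Let pl x := obind Q (W x).

Fact comp_placeK c : pl (iota c) = Some (residue_emb Q c).
Proof. by rewrite /pl iotaE placeK /= placeK. Qed.

Let plP x a : pl x = Some a -> exists2 b, W x = Some b & Q b = Some a.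
Proof. by rewrite /pl; case: (W x) => //= b; exists b. Qed.

Fact comp_placeD x y a b : pl x = Some a -> pl y = Some b -> pl (x + y) = Some (a + b).
Proof.
move=> /plP[c Wx Qc] /plP[d Wy Qd]; rewrite /pl (placeD Wx Wy) /=.
exact: placeD.
Qed.

Fact comp_placeM x y a b : pl x = Some a -> pl y = Some b -> pl (x * y) = Some (a * b).
Proof.
move=> /plP[c Wx Qc] /plP[d Wy Qd]; rewrite /pl (placeM Wx Wy) /=.
exact: placeM.
Qed.

Fact comp_placeV x : pl x = None -> pl x^-1 = Some 0.
Proof.
rewrite /pl; case Wx: (W x) => [a|] /=; last by rewrite (placeV Wx) /= place0.
move=> Qa; rewrite (place_inv Wx) /=; first exact: placeV.
by apply: contra_eq_neq Qa => ->; rewrite place0.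
Qed.

Fact comp_place_surj a : exists x, pl x = Some a.
Proof.
have [b Qb] := place_surj a; have [x Wx] := place_surj b.
by exists x; rewrite /pl Wx.
Qed.

Definition comp_place : place iota :=
  Place comp_placeK comp_placeD comp_placeM comp_placeV comp_place_surj.

Lemma comp_placeE x : comp_place x = obind Q (W x). Proof. by []. Qed.

(** The value group of a composite is an extension of that of [W] by that of [Q]:
    generators of the first together with lifts of generators of the second. *)
Lemma comp_value_group_fg :
  value_group_fg W -> value_group_fg Q -> value_group_fg comp_place.
Proof.
move=> [n [g [g0 gW]]] [m [h [h0 hQ]]].
have /choice[h' h'E] : forall j, exists y, W y = Some (h j) by move=> j; exact: place_surj.
have h'0 j : h' j != 0.
  by apply: contra_neq (h0 j) => h'0; have := h'E j; rewrite h'0 place0 => -[<-].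
exists (n + m)%N, (fun i => match fintype.split i with inl i => g i | inr j => h' j end).
split=> [i|x x0]; first by case: fintype.split.
have [eg [xy yx]] := gW x x0; set y := \prod_(i < n) _ in xy yx.
have y0 : y != 0 by apply/prodf_neq0 => i _; rewrite expfz_neq0.
have [a Wa a0] : exists2 a, W (x / y) = Some a & a != 0.
  by apply: place_unit => //; rewrite ?mulf_neq0 ?invr_eq0 // invf_div.
have [eh [ab ba]] := hQ a a0; set b := \prod_(j < m) _ in ab ba.
pose z := \prod_(j < m) h' j ^ eh j.
have Wz : W z = Some b.
  by apply: place_prod => j _; apply: place_expz.
have b0 : b != 0 by apply/prodf_neq0 => i _; rewrite expfz_neq0.
have z0 : z != 0 by apply/prodf_neq0 => i _; rewrite expfz_neq0.
exists (fun i => match fintype.split i with inl i => eg i | inr j => eh j end).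
have -> : \prod_(i < n + m) match fintype.split i with inl i0 => g i0 | inr j => h' j end
      ^ match fintype.split i with inl i0 => eg i0 | inr j => eh j end = y * z.
  rewrite big_split_ord; congr (_ * _); apply: eq_bigr => i _.
    by rewrite (unsplitK (inl i)).
  by rewrite (unsplitK (inr i)).
have Wab : W (x / (y * z)) = Some (a / b).
  by rewrite invfM mulrA; apply: placeM Wa (place_inv Wz b0).
have Wba : W (y * z / x) = Some (b / a).
  rewrite -[y * z / x]invf_div -[b / a]invf_div.
  by apply: place_inv; rewrite ?mulf_neq0 ?invr_eq0.
by split; rewrite /val_ring /= /pl ?Wab ?Wba.
Qed.
End Composition.

Section TrivialPlace.
Variables (K F : fieldType) (iota : {rmorphism K -> F}).

Fact trivial_placeV (x : F) : Some x = None -> Some x^-1 = Some 0.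
Proof. by []. Qed.
Fact trivial_placeD (x y a b : F) :
  Some x = Some a -> Some y = Some b -> Some (x + y) = Some (a + b).
Proof. by move=> [->] [->]. Qed.
Fact trivial_placeM (x y a b : F) :
  Some x = Some a -> Some y = Some b -> Some (x * y) = Some (a * b).
Proof. by move=> [->] [->]. Qed.
Fact trivial_place_surj (a : F) : exists x, Some x = Some a.
Proof. by exists a. Qed.

Definition trivial_place : place iota :=
  @Place K F iota F iota Some (fun=> erefl) trivial_placeD trivial_placeM
    trivial_placeV trivial_place_surj.

Lemma trivial_value_group_fg : value_group_fg trivial_place.
Proof.
exists 0, (fun=> 1); split=> [i|x x0]; first exact: oner_neq0.
by exists (fun=> 0).
Qed.
End TrivialPlace.

(** * Places of function fields in one variable *)

Section PlaceEval.
Variables (E F : fieldType) (e : {rmorphism E -> F}) (W : place e) (z : F).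
Hypothesis Wz : W z = Some 0.

Lemma place_eval p : W (eval_at e z p) = Some (residue_emb W p`_0).
Proof.
elim/poly_ind: p => [|p c IH]; first by rewrite rmorph0 place0 coef0 rmorph0.
rewrite rmorphD rmorphM /= eval_atX eval_atC coefD coefMX coefC /= add0r.
rewrite -[residue_emb W c]add0r -[X in Some (X + _)](mulr0 (residue_emb W p`_0)).
by apply: placeD (placeM IH Wz) (placeK W c).
Qed.

Hypothesis z0 : z != 0.

(** On E[z] the place is the z-adic one.  Choosing a uniformizer among the elements
    of positive value avoids any discussion of prime polynomials. *)
Lemma eval_order p : p != 0 ->
  exists k u a, [/\ eval_at e z p = z ^+ k * u, W u = Some a & a != 0].
Proof.
elim/poly_ind: p => [|p c IH]; first by rewrite eqxx.
have [->|c0 _] := eqVneq c 0; last first.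
  exists 0, (eval_at e z (p * 'X + c%:P)), (residue_emb W c); split.
  - by rewrite mul1r.
  - by rewrite place_eval coefD coefMX coefC /= add0r.
  by rewrite fmorph_eq0.
rewrite addr0 => pX; have [|k [u [a [pE Wu a0]]]] := IH.
  by apply: contra_neq pX => ->; rewrite mul0r.
by exists k.+1, u, a; split=> //; rewrite rmorphM /= eval_atX pE exprS mulrC mulrA.
Qed.

Lemma eval_neq0 p : p != 0 -> eval_at e z p != 0.
Proof.
move=> /eval_order[k [u [a [-> Wu a0]]]]; rewrite mulf_neq0 ?expf_neq0 //.
by apply: contra_neq a0 => u0; move: Wu; rewrite u0 place0 => -[<-].
Qed.

Lemma place_not_algebraic : ~ algebraicOver e z.
Proof. by move=> [p /eval_neq0]; rewrite eval_atE => /negP pz /pz. Qed.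
End PlaceEval.

Lemma poly_lin_dep (E F : fieldType) (e : {rmorphism E -> F}) z :
  finite_extension (imemb (f := eval_at e z)) ->
  exists m, forall y : 'I_m.+1 -> F, exists r : 'I_m.+1 -> {poly E},
    (exists i, r i != 0) /\ \sum_i eval_at e z (r i) * y i = 0.
Proof.
move=> /finite_lin_dep[m dep]; exists m => y.
have [c [i ci] cy] := dep y.
have [d [r [d0 rE]]] := imfrac_common (fun i => imvalP (c i)).
exists r; split.
  exists i; apply: contra_neq ci => ri; apply/val_inj/(mulfI d0).
  by rewrite /= rE ri rmorph0 mulr0.
transitivity (eval_at e z d * \sum_i imemb (c i) * y i); last by rewrite cy mulr0.
by rewrite mulr_sumr; apply: eq_bigr => j _; rewrite mulrA rE.
Qed.

(** Divide by a term of largest value: the residues add up to 0 and one of them is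
    1, so that another one is not 0. *)
Lemma same_value_sum (K F : fieldType) (iota : {rmorphism K -> F}) (P : place iota)
    (I : finType) (x : I -> F) i0 : x i0 != 0 -> \sum_i x i = 0 ->
  exists i j, [/\ i != j, x i != 0, x j != 0 & same_value P (x i) (x j)].
Proof.
move=> xi0 sx; have [|i xi xmax] := place_max P (x := x); first by exists i0.
have /choice[a aE] : forall j, exists a, P (x j / x i) = Some a.
  by move=> j; apply/place_ringP/xmax.
have [j ji aj] : exists2 j, j != i & a j != 0.
  apply: contrapT => na; have : P (\sum_j x j / x i) = Some (\sum_j a j).
    by apply: place_sum => j _.
  rewrite -mulr_suml sx mul0r place0 (bigD1 i) //= big1 => [[]|j ji].
    have := aE i; rewrite divff // place1 addr0 => -[<-] /esym /eqP.
    by rewrite oner_eq0.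
  by apply/eqP/contraT => aj; case: na; exists j.
exists j, i; split=> //.
  by apply: contra_neq aj => xj; have := aE j; rewrite xj mul0r place0 => -[].
split; rewrite /val_ring /= ?aE //.
by rewrite -[x i / x j]invf_div (place_inv (aE j)).
Qed.

Section CurvePlace.
Variables (E F : fieldType) (e : {rmorphism E -> F}) (W : place e) (z : F).
Hypotheses (Wz : W z = Some 0) (z0 : z != 0).
Hypothesis Ffin : finite_extension (imemb (f := eval_at e z)).

(** Divide a relation over E[z] by the highest common power of z. *)
Lemma primitive_relation (I : finType) (y : I -> F) (r : I -> {poly E}) i :
  r i != 0 -> \sum_j eval_at e z (r j) * y j = 0 ->
  exists r' : I -> {poly E},
    (exists j, (r' j)`_0 != 0) /\ \sum_j eval_at e z (r' j) * y j = 0.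
Proof.
have [N] := ubnP (size (r i)); elim: N r => // N IH r sN ri ry.
have [[j rj]|nr] := pselect (exists j, (r j)`_0 != 0).
  by exists r; split=> //; exists j.
have /choice[q qE] : forall j, exists q, r j = q * 'X.
  move=> j; have /factor_theorem[q] : root (r j) 0.
    by apply/contraT; rewrite rootE horner_coef0 => rj; case: nr; exists j.
  by rewrite subr0; exists q.
have qi : q i != 0 by apply: contra_neq ri; rewrite qE => ->; rewrite mul0r.
apply: (IH q) => //.
  by move: sN; rewrite qE size_mulX.
apply: (mulfI z0); rewrite mulr0 -[RHS]ry mulr_sumr; apply: eq_bigr => j _.
by rewrite qE rmorphM /= eval_atX mulrCA mulrA.
Qed.

(** Lifts of residues satisfy a linear relation over E[z] of bounded length, which
    can be made primitive and then specialized at z = 0. *)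
Lemma curve_residue_finite : residue_finite W.
Proof.
have [m dep] := poly_lin_dep Ffin.
apply: (@lin_dep_finite _ _ _ m) => yb.
have /choice[y yE] : forall i, exists x, W x = Some (yb i).
  by move=> i; exact: place_surj.
have [r0 [[i ri] ry0]] := dep y.
have [r [[j rj] ry]] := primitive_relation ri ry0.
exists (fun i => (r i)`_0); first by exists j.
have : W (\sum_i eval_at e z (r i) * y i) = Some (\sum_i residue_emb W (r i)`_0 * yb i).
  by apply: place_sum => k _; apply: placeM => //; apply: place_eval.
by rewrite ry place0 => -[].
Qed.

(** Equality of values modulo the subgroup generated by the value of z. *)
Definition commensurable x y := exists k : int, same_value W x (y * z ^ k).

Lemma commensurable_sym x y : commensurable x y -> commensurable y x.
Proof.
have swap u v k : u / (v * z ^ (- k)) = u * z ^ k / v.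
  by rewrite invfM -invr_expz invrK mulrA mulrAC.
move=> [k [xy yx]]; exists (- k); split; first by rewrite swap.
by rewrite -invf_div swap invf_div.
Qed.

(** By the dominance principle two terms of the relation have the same value, and
    the value of a coefficient in E[z] is a multiple of that of z. *)
Lemma commensurable_pair m (x : 'I_m.+1 -> F) (r : 'I_m.+1 -> {poly E}) i0 :
  (forall i, x i != 0) -> r i0 != 0 -> \sum_i eval_at e z (r i) * x i = 0 ->
  exists i j, i != j /\ commensurable (x i) (x j).
Proof.
move=> x0 ri0 rx.
have [|i [j [ij Ti Tj [sij sji]]]] := @same_value_sum _ _ _ W _ _ i0 _ rx.
  by rewrite mulf_neq0 // (eval_neq0 Wz).
exists i, j; split=> //.
have ri : r i != 0 by apply: contra_neq Ti => ->; rewrite rmorph0 mul0r.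
have rj : r j != 0 by apply: contra_neq Tj => ->; rewrite rmorph0 mul0r.
have [a [u [ub [riE Wu ub0]]]] := eval_order Wz ri.
have [b [v [vb [rjE Wv vb0]]]] := eval_order Wz rj.
have u0 : u != 0 by move: Ti; rewrite riE !mulf_eq0 !negb_or => /andP[/andP[]].
have v0 : v != 0 by move: Tj; rewrite rjE !mulf_eq0 !negb_or => /andP[/andP[]].
have uP : u / v \in place_ring W.
  by apply/place_ringP; eexists; apply: placeM Wu (place_inv Wv vb0).
have vP : v / u \in place_ring W.
  by apply/place_ringP; eexists; apply: placeM Wv (place_inv Wu ub0).
exists (b%:Z - a%:Z).
have -> : z ^ (b%:Z - a%:Z) = z ^+ b / z ^+ a by rewrite expfzDr // exprnN.
have za0 : z ^+ a != 0 by rewrite expf_neq0.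
have zb0 : z ^+ b != 0 by rewrite expf_neq0.
move: sij sji (x0 i) (x0 j); rewrite /val_ring /= riE rjE => sij sji xi xj.
split; rewrite /val_ring /=.
  have -> : x i / (x j * (z ^+ b / z ^+ a)) =
     z ^+ a * u * x i / (z ^+ b * v * x j) * (v / u).
    by field; rewrite ?za0 ?zb0 ?u0 ?v0 ?xi ?xj.
  exact: (rpredM (s := place_ring W)).
have -> : x j * (z ^+ b / z ^+ a) / x i =
   z ^+ b * v * x j / (z ^+ a * u * x i) * (u / v).
  by field; rewrite ?za0 ?zb0 ?u0 ?v0 ?xi ?xj.
exact: (rpredM (s := place_ring W)).
Qed.

Lemma commensurable_reps m :
  (forall x : 'I_m.+1 -> F, (forall i, x i != 0) ->
     exists i j, i != j /\ commensurable (x i) (x j)) ->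
  exists n (g : 'I_n -> F), (forall i, g i != 0) /\
    forall x, x != 0 -> exists i, commensurable x (g i).
Proof.
elim: m => [|m IH] com.
  by have [|i [j [/negP]]] := com (fun=> 1) _; rewrite ?oner_neq0 // !ord1 eqxx.
have [com'|/existsNP[g /not_implyP[g0 gN]]] := pselect
    (forall x : 'I_m.+1 -> F, (forall i, x i != 0) ->
     exists i j, i != j /\ commensurable (x i) (x j)).
  exact: IH.
exists m.+1, g; split=> // x x0.
have [|i [j [ij cij]]] := com (fun i => oapp g x (unlift ord0 i)).
  by move=> i; case: unlift => [k|] /=.
move: ij cij; case: (unliftP ord0 i) => [i' ->|->]; case: (unliftP ord0 j) => [j' ->|->] /=.
- rewrite (inj_eq lift_inj) => ij c; case: gN; by exists i', j'.
- by move=> _ /commensurable_sym c; exists i'.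
- by move=> _ c; exists j'.
by move=> /eqP.
Qed.

(** The value group has finitely many classes modulo the multiples of the value of
    z. *)
Lemma curve_value_group_fg : value_group_fg W.
Proof.
have [m dep] := poly_lin_dep Ffin.
have [|n [g [g0 gE]]] := @commensurable_reps m.
  move=> x x0; have [r [[i ri] rx]] := dep x.
  exact: commensurable_pair ri rx.
exists n.+1, (fun i => oapp g z (unlift ord0 i)); split=> [i|x x0].
  by case: unlift => [k|] /=.
have [i [k xk]] := gE x x0.
exists (fun j => if unlift ord0 j is Some j' then (j' == i)%:Z else k).
rewrite big_ord_recl unlift_none /= mulrC.
rewrite (bigD1 i) //= liftK eqxx expr1z big1 ?mulr1 // => j ji.
by rewrite liftK (negPf ji) expr0z.
Qed.
End CurvePlace.

(** * Places finite on a given finite set *)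

Lemma integral_eval (R R' : comNzRingType) (F : fieldType)
    (f : {rmorphism R -> F}) (g : {rmorphism R' -> F}) s p :
  (forall c, integralOver g (f c)) -> integralOver g s ->
  integralOver g (eval_at f s p).
Proof.
move=> fg gs; rewrite eval_atE; apply: integral_horner => //.
by apply/integral_poly => i; rewrite coef_map; apply: fg.
Qed.

Lemma integral_eval_const (R : comNzRingType) (F : fieldType) (f : {rmorphism R -> F})
    s c : integralOver (eval_at f s) (f c).
Proof. by rewrite -(eval_atC f s); apply: integral_id. Qed.

Lemma integral_eval_var (R : comNzRingType) (F : fieldType) (f : {rmorphism R -> F}) s :
  integralOver (eval_at f s) s.
Proof. by rewrite -[X in integralOver _ X](eval_atX f s); apply: integral_id. Qed.

Lemma imemb_algebraic (R : comNzRingType) (L F : fieldType) (f : {rmorphism R -> F})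
    (g : {rmorphism L -> F}) (x : imfield f) :
  (forall r, integralOver g (f r)) -> algebraicOver g (imemb x).
Proof.
move=> fg; have /imfracP[p [q [_ xE]]] := imvalP x.
by rewrite [X in algebraicOver _ X]xE; apply: algebraic_div; apply/integral_algebraic.
Qed.

Lemma integral_algebraic_imfrac (R : comNzRingType) (F : fieldType)
    (f : {rmorphism R -> F}) x :
  integralOver f x -> algebraicOver (imemb (f := f)) x.
Proof.
move=> fx; apply/integral_algebraic; apply: integral_trans fx => r.
exact: (integral_id _ (to_imfield f r)).
Qed.

Lemma mmapXi (R S : nzRingType) n (f : {rmorphism R -> S}) (t : 'I_n -> S) i :
  mmap f t (mpolyX R (mnm1 i)) = t i.
Proof. by rewrite mmapX mmap1U. Qed.

Lemma integral_mmap (K F : fieldType) (R : comNzRingType) (iota : {rmorphism K -> F})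
    (g : {rmorphism R -> F}) n (t : 'I_n -> F) p :
  (forall c, integralOver g (iota c)) -> (forall i, integralOver g (t i)) ->
  integralOver g (mmap iota t p).
Proof.
move=> gi gt; apply: (big_ind (integralOver g)); first exact: integral0.
  exact: integral_add.
move=> m _; apply: integral_mul => //.
apply: (big_ind (integralOver g)); [exact: integral1|exact: integral_mul|].
move=> i _; elim: (m i) => [|k IH]; first exact: integral1.
by rewrite exprS; apply: integral_mul.
Qed.

Lemma rmorph_mpoly (R S : comNzRingType) n (h : {rmorphism mpoly n R -> S}) p :
  h p = mmap (h \o @mpolyC n R) (fun i => h (mpolyX R (mnm1 i))) p.
Proof.
rewrite [p in LHS]mpolyE rmorph_sum; apply: eq_bigr => m _.
rewrite -mul_mpolyC rmorphM; congr (_ * _).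
by rewrite mpolyXE_id rmorph_prod; apply: eq_bigr => i _; rewrite rmorphXn.
Qed.

Lemma rmorph_mmap (R S T : comNzRingType) n (f : {rmorphism R -> S}) (t : 'I_n -> S)
    (h : {rmorphism S -> T}) p :
  h (mmap f t p) = mmap (h \o f) (fun i => h (t i)) p.
Proof.
rewrite rmorph_sum; apply: eq_bigr => m _; rewrite rmorphM; congr (_ * _).
by rewrite rmorph_prod; apply: eq_bigr => i _; rewrite rmorphXn.
Qed.

Lemma rmorph_eval (R : comNzRingType) (F G : fieldType) (f : {rmorphism R -> F}) s
    (h : {rmorphism F -> G}) p :
  h (eval_at f s p) = eval_at (h \o f) (h s) p.
Proof. by rewrite !eval_atE -horner_map -map_poly_comp. Qed.

Lemma fg_imfrac (E F : fieldType) (e : {rmorphism E -> F}) s :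
  finitely_generated_field e -> finitely_generated_field (imemb (f := eval_at e s)).
Proof.
move=> [l gl]; exists l => S Sd Se Sl; apply: gl => // c.
by rewrite -(eval_atC e s); apply: (Se (to_imfield (eval_at e s) c%:P)).
Qed.

(** The field is finite over E(z) for any z of positive value, because z is
    transcendental and can be exchanged with s; so the two lemmas above cover all
    nontrivial places. *)
Lemma curve_place_small (E F : fieldType) (e : {rmorphism E -> F}) (W : place e) s z :
  finitely_generated_field e ->
  (forall x, algebraicOver (imemb (f := eval_at e s)) x) ->
  W z = Some 0 -> z != 0 -> value_group_fg W /\ residue_finite W.
Proof.
move=> fg alg Wz z0.
have sz : algebraicOver (imemb (f := eval_at e z)) s.
  exact: exchange (alg z) (place_not_algebraic Wz z0).
have ez c : algebraicOver (imemb (f := eval_at e z)) (e c).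
  exact/integral_algebraic_imfrac/integral_eval_const.
have Ffin : finite_extension (imemb (f := eval_at e z)).
  apply: fg_algebraic_finite => [|x]; first exact: fg_imfrac.
  apply: algebraic_trans (alg x) => r; apply: imemb_algebraic => p.
  by apply: integral_eval => [c|]; apply/integral_algebraic.
split; first exact: curve_value_group_fg Ffin.
exact: curve_residue_finite Ffin.
Qed.

(** With y' = y + 1/d(y), the relation (y' - y) d(y) = 1 is, up to a constant, a
    monic equation for y over E[y']; then 1/d(y) = y' - y is integral as well. *)
Lemma integral_shift (E F : fieldType) (e : {rmorphism E -> F}) y d :
  eval_at e y d != 0 -> integralOver (eval_at e (y + (eval_at e y d)^-1)) y.
Proof.
set c := eval_at e y d => c0; set y' := y + c^-1.
have d0 : d != 0 by apply: contra_neq c0; rewrite /c => ->; rewrite rmorph0.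
pose T : {poly {poly E}} := d^:P * ('X - 'X%:P) + 1.
have sd : size d^:P = size d by rewrite size_map_polyC.
have dC0 : d^:P != 0 by rewrite -size_poly_gt0 sd size_poly_gt0.
have lT : lead_coef T = (lead_coef d)%:P.
  rewrite lead_coefDl.
    by rewrite lead_coefM lead_coefXsubC mulr1 lead_coef_map_inj //; apply: polyC_inj.
  rewrite size_poly1 size_Mmonic ?monicXsubC // size_XsubC addn2 /= sd.
  by rewrite ltnS size_poly_gt0.
exists ((lead_coef d)^-1%:P *: T).
  by rewrite monicE lead_coefZ lT -polyCM mulVf // lead_coef_eq0.
rewrite linearZ /= rootZ; last first.
  by rewrite eval_atC fmorph_eq0 invr_eq0 lead_coef_eq0.
rewrite rootE rmorphD rmorphM rmorphB rmorph1 /= map_polyX map_polyC /= eval_atX.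
have -> : map_poly (eval_at e y') d^:P = map_poly e d.
  by apply/polyP => i; rewrite !coef_map /= eval_atC.
rewrite !hornerE -[_.[y]]/c /y' opprD addrA subrr add0r mulrN divff //.
by rewrite addNr.
Qed.

(** Noether normalization in dimension one, valid over finite fields too: each new
    element is integral over E[y] away from the zeros of some d(y), and replacing
    y by y + 1/d(y) sends these zeros to infinity. *)
Lemma integral_over_line (E F : fieldType) (e : {rmorphism E -> F}) s (a : seq F) :
  ~ algebraicOver e s -> (forall x, algebraicOver (imemb (f := eval_at e s)) x) ->
  exists y, ~ algebraicOver e y /\ {in s :: a, forall x, integralOver (eval_at e y) x}.
Proof.
move=> sN alg; elim: a => [|x a [y [yN ya]]].
  exists s; split=> // x; rewrite inE => /eqP->.
  exact: integral_eval_var.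
have : algebraicOver (imemb (f := eval_at e y)) x.
  apply: algebraic_trans (alg x) => r; apply: imemb_algebraic => p.
  apply/integral_algebraic/integral_algebraic_imfrac/integral_eval.
    exact: integral_eval_const.
  exact: ya (mem_head _ _).
move=> /algebraic_imfrac[q q0 qx].
set c := lead_coef (map_poly (eval_at e y) q).
have c0 : c != 0 by rewrite lead_coef_eq0.
have [d cE] : exists d, c = eval_at e y d by rewrite /c lead_coefE coef_map; eexists.
rewrite cE in c0; have yint := integral_shift c0; set y' := y + _ in yint.
have y'int p : integralOver (eval_at e y') (eval_at e y p).
  apply: integral_eval yint => c'; exact: integral_eval_const.
have cVint : integralOver (eval_at e y') c^-1.
  have -> : c^-1 = y' - y by rewrite cE /y' addrC addKr.
  by apply: integral_sub => //; apply: integral_eval_var.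
exists y'; split.
  move=> y'alg; apply: yN; apply/integral_algebraic.
  apply: integral_trans yint => p; apply: integral_eval => [c'|].
    exact: integral_id.
  exact/integral_algebraic.
move=> v; rewrite !inE => /or3P[/eqP->|/eqP->|va].
- by apply: integral_trans (ya s (mem_head _ _)).
- apply: (@integral_root_monic _ _ _ _ (c^-1 *: map_poly (eval_at e y) q)).
  + by rewrite monicE lead_coefZ mulVf // cE.
  + by rewrite rootZ // invr_eq0 cE.
  apply/integral_poly => i; rewrite coefZ coef_map; apply: integral_mul => //; apply: y'int.
by apply: integral_trans (ya v _); rewrite // inE va orbT.
Qed.

Lemma transcendental_inv_not_integral (E F : fieldType) (e : {rmorphism E -> F}) y :
  ~ algebraicOver e y -> ~ integralOver (eval_at e y) y^-1.
Proof.
move=> yN; pose S : {pred F} := [pred x | `[< exists p, x = eval_at e y p >]].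
have SP x : x \in S <-> exists p, x = eval_at e y p by split=> /asboolP.
have Scl : subring_closed S.
  split=> [|_ _ /SP[p ->] /SP[q ->]|_ _ /SP[p ->] /SP[q ->]]; apply/SP.
  - by exists 1; rewrite rmorph1.
  - by exists (p - q); rewrite rmorphB.
  by exists (p * q); rewrite rmorphM.
pose S' : subringClosed F := HB.pack S (GRing.isSubringClosed.Build F S Scl).
have S'P r : eval_at e y r \in S' by apply/SP; exists r.
have yS : y \in S' by rewrite -[y](eval_atX e); apply: S'P.
move=> /(integral_inv_in S'P yS)/SP[p yE].
have y0 : y != 0.
  by apply/eqP => y0; apply: yN; rewrite y0; apply: algebraic0.
apply: yN.
exists ('X * p - 1).
  apply/eqP => /polyP/(_ 0); rewrite coefB coefXM coef1 coef0 sub0r => /eqP.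
  by rewrite oppr_eq0 oner_eq0.
rewrite rootE -eval_atE rmorphB rmorphM rmorph1 /= eval_atX -yE divff //.
by rewrite subrr.
Qed.

(** Lets the subfield K(t) play the part of the generated field in the next lemma. *)
Lemma imfield_generated (K F : fieldType) n (f : {rmorphism mpoly n K -> F})
    (y : imfield f) :
  y \in imfrac (mmap (to_imfield f \o @mpolyC n K)
    (fun i => to_imfield f (mpolyX K (mnm1 i)))).
Proof.
pose k' : {rmorphism K -> imfield f} := to_imfield f \o @mpolyC n K.
pose t' (i : 'I_n) : imfield f := to_imfield f (mpolyX K (mnm1 i)).
change (y \in imfrac (mmap k' t')).
have /imfracP[p [q [q0 yE]]] := imvalP y; apply/imfracP; exists p, q.
have gE r : to_imfield f r = mmap k' t' r by rewrite rmorph_mpoly.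
change (mmap k' t' q != 0 /\ y = mmap k' t' p / mmap k' t' q).
by rewrite -!gE; split=> //; apply: val_inj.
Qed.

(** Induction on the number of generators of E.  Let E' be generated by all but
    the first one, s.  If s is algebraic over E', then F is finite over E'.
    Otherwise F is a function field in one variable over E', and [a] is integral
    over E'[y] for some y; a zero of y gives a place with residue field finite
    over E', to be composed with a place of that field obtained by induction. *)
Lemma small_place_exists n : forall (K E : fieldType) (k : {rmorphism K -> E})
    (t : 'I_n -> E), (forall y, y \in imfrac (mmap k t)) ->
  forall (F : fieldType) (e : {rmorphism E -> F}), finite_extension e ->
  forall (iota : {rmorphism K -> F}), (forall c, iota c = e (k c)) ->
  forall a : seq F, exists Q : place iota,
    [/\ value_group_fg Q, residue_finite Q & {subset a <= place_ring Q}].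
Proof.
elim: n => [|n IH] K E k t Et F e fin iota iotaE a.
  exists (trivial_place iota); split=> //; first exact: trivial_value_group_fg.
  have [m [b bE]] := fin; exists m, b => x; have [c ->] := bE x.
  have /choice[c' c'E] : forall i, exists c', c i = k c'.
    move=> i; have : c i \in imfrac k.
      apply: imfrac_sub (Et _) => p; apply: mmap_in => [c'|[]//].
      exact: imfrac_id.
    by move=> /imfracP[p [q [q0 ->]]]; exists (p / q); rewrite fmorph_div.
  by exists c'; apply: eq_bigr => i _; rewrite c'E [RHS]/= iotaE.
pose g := mmap k (fun i => t (lift ord0 i)).
pose E' : fieldType := imfield g.
pose k' : {rmorphism K -> E'} := to_imfield g \o @mpolyC n K.
pose e1 : {rmorphism E' -> E} := imemb (f := g).
pose t' (i : 'I_n) : E' := to_imfield g (mpolyX K (mnm1 i)).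
have ek c : e1 (k' c) = k c by rewrite -(mmapC (fun i => t (lift ord0 i)) k c).
have et i : e1 (t' i) = t (lift ord0 i).
  by rewrite -(mmapXi k (fun i => t (lift ord0 i)) i).
pose s := t ord0; pose e' : {rmorphism E' -> F} := e \o e1.
have Es y : y \in imfrac (eval_at e1 s).
  apply: imfrac_sub (Et y) => p; apply: mmap_in => [c|i].
    by rewrite -ek -(eval_atC e1 s); apply: imfrac_id.
  case: (unliftP ord0 i) => [j ->|->].
    by rewrite -et -(eval_atC e1 s); apply: imfrac_id.
  by rewrite -[t ord0](eval_atX e1); apply: imfrac_id.
have eEs y : e y \in imfrac (eval_at e' (e s)).
  have /imfracP[p [q [q0 ->]]] := Es y; rewrite fmorph_div !rmorph_eval.
  by rewrite rpred_div // imfrac_id.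
have fg : finitely_generated_field e'.
  have [m [b bE]] := fin; exists (e s :: codom b) => S Sd Se Sb x.
  pose S' : divringClosed F := HB.pack S (GRing.isDivringClosed.Build F S Sd).
  have [c ->] := bE x; apply: (rpred_sum (S := S')) => i _.
  apply: (rpredM (s := S')); last by apply: Sb; rewrite inE codom_f orbT.
  have /imfracP[p [q [q0 ->]]] := eEs (c i).
  by apply: (rpred_div (S := S')); apply: eval_at_in => //; apply: Sb; rewrite mem_head.
have alg x : algebraicOver (imemb (f := eval_at e' (e s))) x.
  apply: algebraic_sub_range (finite_algebraic fin x) => r.
  by exists (ImField (eEs r)).
have iotaE' c : iota c = e' (k' c) by rewrite iotaE -ek.
have [salg|sN] := pselect (algebraicOver e' (e s)).
  apply: (IH K E' k' t' (imfield_generated (f := g)) F e') => //.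
  apply: fg_algebraic_finite => // x; apply: algebraic_trans (alg x) => r.
  apply: imemb_algebraic => p; apply: integral_eval => [c|]; first exact: integral_id.
  exact/integral_algebraic.
have [y [yN ya]] := integral_over_line a sN alg.
have [|W [Wy WyV]] := chevalley _ (transcendental_inv_not_integral yN) (iota := e').
  by move=> c; exists c%:P; exact: esym (eval_atC _ _ _).
have y0 : y != 0.
  by apply/eqP => y0; apply: yN; rewrite y0; apply: algebraic0.
have Wy0 : W y = Some 0 by rewrite -[y]invrK; apply: placeV.
have [Wvg Wfin] := curve_place_small fg alg Wy0 y0.
have aW x : x \in a -> x \in place_ring W.
  by move=> xa; apply: place_integral Wy (ya x _); rewrite inE xa orbT.
have [Q [Qvg Qfin Qa]] := IH K E' k' t' (imfield_generated (f := g)) _ (residue_emb W) Wfin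
  (residue_emb W \o k') (fun=> erefl) [seq odflt 0 (W x) | x <- a].
exists (comp_place iotaE' Q); split=> //; first exact: comp_value_group_fg.
move=> x xa; have /place_ringP[b Wx] := aW x xa.
rewrite inE comp_placeE Wx /=; apply: Qa; apply/mapP; exists x => //.
by rewrite Wx.
Qed.

(** * Noether normalization *)

Lemma digits_inj N n (m m' : 'I_n -> nat) :
  (forall i, m i < N)%N -> (forall i, m' i < N)%N ->
  (\sum_i m i * N ^ i = \sum_i m' i * N ^ i)%N -> m =1 m'.
Proof.
elim: n m m' => [|n IH] m m' mN m'N; first by move=> _ [].
have N0 : (0 < N)%N by apply: leq_trans (mN ord0).
have shift (f : 'I_n.+1 -> nat) : (\sum_i f i * N ^ i =
    (\sum_(i < n) f (lift ord0 i) * N ^ i) * N + f ord0)%N.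
  rewrite big_ord_recl expn0 muln1 addnC big_distrl; congr (_ + _)%N.
  by apply: eq_bigr => i _; rewrite /= /bump add1n expnSr mulnA.
rewrite !shift => /(f_equal (edivn^~ N)); rewrite !edivn_eq // => -[sE fE] i.
case: (unliftP ord0 i) => [j ->|->] //.
by have /(_ _ _ sE j) := IH (fun i => m (lift ord0 i)) (fun i => m' (lift ord0 i)); apply.
Qed.


Lemma mmap_ext (R S : nzRingType) n (f g : R -> S) (t u : 'I_n -> S) p :
  f =1 g -> t =1 u -> mmap f t p = mmap g u p.
Proof.
by move=> fg tu; apply: eq_bigr => m _; rewrite fg (mmap1_eq _ tu).
Qed.

Section NoetherStep.
Variables (K F : fieldType) (iota : {rmorphism K -> F}) (n : nat) (t : 'I_n.+1 -> F).
Variables (p : mpoly n.+1 K) (N : nat).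
Hypothesis p0 : p != 0.
Hypothesis pt : mmap iota t p = 0.
Hypothesis pN : {in msupp p, forall m : multinom n.+1, forall i, (m i < N)%N}.

(* The shift gives the monomial with exponent m the degree sum_i m_i N^i in t_0.
   As the m_i are digits in base N, distinct monomials get distinct degrees. *)
Definition noether_shift (j : 'I_n) : F := t (lift ord0 j) - t ord0 ^+ (N ^ j.+1).

Local Notation R := (mpoly n K).
Local Notation phi := (mmap iota noether_shift).

Let h (i : 'I_n.+1) : {poly R} :=
  if unlift ord0 i is Some j then (mpolyX K (mnm1 j))%:P + 'X^(N ^ j.+1) else 'X.

Let w (m : multinom n.+1) := (\sum_i m i * N ^ i)%N.

Let monic_size (d : nat) (g : {poly R}) := g \is monic /\ size g = d.+1.

Let monic_sizeM d d' g g' : monic_size d g -> monic_size d' g' ->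
  monic_size (d + d') (g * g').
Proof.
move=> [gm gs] [gm' gs']; split; first by rewrite monicMl.
by rewrite size_monicM ?monic_neq0 // gs gs' addSn addnS.
Qed.

Let monic_size_exp d g k : monic_size d g -> monic_size (k * d) (g ^+ k).
Proof.
move=> gd; elim: k => [|k IH]; first by split; rewrite ?expr0 ?monic1 ?size_poly1.
by rewrite exprS mulSn; apply: monic_sizeM.
Qed.

Let N0 : (0 < N)%N.
Proof.
have : msupp p != [::] by rewrite msupp_eq0.
case E: (msupp p) => [//|m s] _.
have mp : m \in msupp p by rewrite E mem_head.
exact: leq_trans (pN mp ord0).
Qed.

Let h_monic (i : 'I_n.+1) : monic_size (N ^ i) (h i).
Proof.
rewrite /h; case: unliftP => [j ->|->]; last first.
  by split; rewrite ?monicX // size_polyX expn0.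
rewrite /= /bump add1n addrC; have Nj : (0 < N ^ j.+1)%N by rewrite expn_gt0 N0.
have sC c : (size (c%:P : {poly R}) < size ('X^(N ^ j.+1) : {poly R}))%N.
  by rewrite size_polyXn ltnS (leq_trans (size_polyC_leq1 _)).
split; last by rewrite (size_polyDl (sC _)) size_polyXn.
by rewrite monicE (lead_coefDl (sC _)) lead_coefXn.
Qed.

Let mmap1_monic m : monic_size (w m) (mmap1 h m).
Proof.
rewrite /w /mmap1; elim/big_rec2: _ => [|i d g _ IH].
  by split; rewrite ?monic1 ?size_poly1.
exact: monic_sizeM (monic_size_exp _ (h_monic i)) IH.
Qed.

(* p written in terms of the shifted variables, as a polynomial in t_0 *)
Let q := mmap (polyC \o @mpolyC n K) h p.

Let coef_q i : q`_i = \sum_(m <- msupp p) (mpolyC n (mcoeff m p)) * (mmap1 h m)`_i.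
Proof. by rewrite coef_sum; apply: eq_bigr => m _; rewrite coefCM. Qed.

Let q_monic : exists c, (mpolyC n c) *: q \is monic.
Proof.
have [m mp mmax] : exists2 m, m \in msupp p & {in msupp p, forall m', (w m' <= w m)%N}.
  have : msupp p != [::] by rewrite msupp_eq0.
  elim: (msupp p) => // m s IH _; case: (eqVneq s [::]) => [->|/IH[x xs xmax]].
    by exists m; rewrite ?mem_head // => y; rewrite inE => /eqP->.
  have [mx|/ltnW xm] := leqP (w m) (w x).
    exists x => [|y]; first by rewrite inE xs orbT.
    by rewrite inE => /predU1P[->//|/xmax].
  exists m => [|y]; first by rewrite mem_head.
  by rewrite inE => /predU1P[->//|/xmax /leq_trans]; apply.
have big i : (w m < i)%N -> q`_i = 0.
  move=> wi; rewrite coef_q big_seq big1 // => m' /mmax wm'.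
  rewrite [_`_i]nth_default ?mulr0 //; have [_ ->] := mmap1_monic m'.
  exact: leq_ltn_trans wi.
have lead : q`_(w m) = mpolyC n (mcoeff m p).
  rewrite coef_q (bigD1_seq m) ?msupp_uniq //= big_seq_cond big1 ?addr0.
    have [/monicP + ms] := mmap1_monic m; rewrite lead_coefE ms /= => ->.
    by rewrite mulr1.
  move=> m' /andP[m'p m'm]; rewrite [_`_(w m)]nth_default ?mulr0 //.
  have [_ ->] := mmap1_monic m'; rewrite ltn_neqAle mmax // andbT.
  apply: contra_neq m'm => /(digits_inj (pN m'p) (pN mp)) mm'.
  exact/mnmP.
exists ((mcoeff m p))^-1; have pm : (mcoeff m p) != 0 by rewrite -mcoeff_msupp.
have cm : ((mpolyC n ((mcoeff m p))^-1) *: q)`_(w m) = 1.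
  by rewrite coefZ lead -mpolyCM mulVf // mpolyC1.
rewrite monicE lead_coefE; suff -> : size (mpolyC n ((mcoeff m p))^-1 *: q) = (w m).+1.
  by rewrite /= cm.
apply/eqP; rewrite eqn_leq; apply/andP; split.
  by apply/leq_sizeP => i wi; rewrite coefZ big ?mulr0.
rewrite ltnNge; apply/negP => /leq_sizeP/(_ _ (leqnn _)); rewrite cm => /eqP.
by rewrite oner_eq0.
Qed.

Let eval_q : eval_at phi (t ord0) q = 0.
Proof.
rewrite -[RHS]pt /q rmorph_mmap; apply: mmap_ext => [c|i] /=.
  exact: etrans (eval_atC _ _ _) (mmapC _ _ _).
rewrite /h; case: unliftP => [j ->|->]; last exact: eval_atX.
rewrite rmorphD rmorphXn /= eval_atX (_ : eval_at _ _ _ = noether_shift j).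
  by rewrite /noether_shift subrK.
exact: etrans (eval_atC _ _ _) (mmapXi _ _ _).
Qed.

(** In terms of the shifted variables the relation becomes, up to a constant, a
    monic equation for t_0: its monomials are monic of distinct degrees. *)
Lemma noether_step i : integralOver phi (t i).
Proof.
have tz : integralOver phi (t ord0).
  have [c qm] := q_monic; exists (mpolyC n c *: q) => //.
  by rewrite rootE -eval_atE -mul_polyC rmorphM /= eval_q mulr0.
case: (unliftP ord0 i) => [j ->|-> //].
rewrite -[t _](subrK (t ord0 ^+ (N ^ j.+1))); apply: integral_add.
  by rewrite -[X in integralOver _ X](mmapXi iota noether_shift); apply: integral_id.
elim: (N ^ j.+1)%N => [|k IH]; first exact: integral1.
by rewrite exprS; apply: integral_mul.
Qed.
End NoetherStep.

Lemma alg_indep_ord0 (K F : fieldType) (iota : {rmorphism K -> F}) (t : 'I_0 -> F) :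
  alg_indep iota t.
Proof.
move=> p; have -> : p = mpolyC 0 (mcoeff (@mnm0 0) p).
  apply/mpolyP => m; rewrite mcoeffC; have -> : m = mnm0 by apply/mnmP => -[].
  by rewrite eqxx mulr1.
by rewrite mmapC => /eqP; rewrite fmorph_eq0 => /eqP ->; rewrite mpolyC0.
Qed.

(** As long as the family is dependent, one variable can be removed.  The subring
    [S] records that the t_i can be kept in the valuation ring of a given place. *)
Lemma noether_normalization (K F : fieldType) (iota : {rmorphism K -> F})
    (S : subringClosed F) (a : seq F) :
  (forall c, iota c \in S) -> {subset a <= S} ->
  exists n (t : 'I_n -> F), [/\ alg_indep iota t, forall i, t i \in S &
    {in a, forall x, integralOver (mmap iota t) x}].
Proof.
move=> iS aS.
suff main n (t : 'I_n -> F) : (forall i, t i \in S) ->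
    {in a, forall x, integralOver (mmap iota t) x} ->
  exists n (t : 'I_n -> F), [/\ alg_indep iota t, forall i, t i \in S &
    {in a, forall x, integralOver (mmap iota t) x}].
  apply: (main _ (tnth (in_tuple a))) => [i|x]; first by rewrite aS ?mem_tnth.
  move=> /(tnthP (in_tuple a))[i ->].
  by rewrite -(mmapXi iota (tnth (in_tuple a))); apply: integral_id.
elim: n t => [|n IH] t tS ta.
  by exists 0, t; split=> //; apply: alg_indep_ord0.
have [tind|/existsNP[p /not_implyP[pt /eqP p0]]] := pselect (alg_indep iota t).
  by exists n.+1, t.
pose N := (\max_(m <- msupp p) \max_(i < n.+1) m i).+1.
have pN : {in msupp p, forall m : multinom n.+1, forall i, (m i < N)%N}.
  move=> m mp i; rewrite ltnS.
  have := @leq_bigmax_seq _ (msupp p) xpredT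
    (fun m : multinom n.+1 => \max_(i < n.+1) m i)%N m mp isT.
  by apply: leq_trans; apply: (leq_bigmax i).
apply: (IH (noether_shift t N)) => [i|x xa].
  by rewrite rpredB ?rpredX.
apply: integral_trans (ta x xa) => r; apply: integral_mmap => [c|i].
  by rewrite -(mmapC (noether_shift t N) iota); apply: integral_id.
exact: noether_step p0 pt pN i.
Qed.

(** * Rational roots and exchange *)

Lemma min_poly_exists (E F : fieldType) (e : {rmorphism E -> F}) x :
  algebraicOver e x -> exists mu : {poly E}, [/\ mu \is monic, root (map_poly e mu) x &
    forall q, root (map_poly e q) x -> mu %| q].
Proof.
move=> [p0 p00 p0x].
pose Q n := `[< exists p : {poly E}, [/\ p != 0, size p = n & root (map_poly e p) x] >].
have exQ : exists n, Q n by exists (size p0); apply/asboolP; exists p0.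
case: (ex_minnP exQ) => n /asboolP[p [pn0 sp px]] pmin.
have lp : lead_coef p != 0 by rewrite lead_coef_eq0.
exists ((lead_coef p)^-1 *: p); split=> [||q qx].
- by rewrite monicE lead_coefZ mulVf.
- by rewrite map_polyZ rootZ // fmorph_eq0 invr_eq0.
rewrite dvdpZl ?invr_eq0 // /dvdp; apply/contraT => qp.
have /pmin : Q (size (q %% p)).
  apply/asboolP; exists (q %% p); split=> //.
  have := divp_eq q p => /(congr1 (fun r => (map_poly e r).[x])).
  rewrite rmorphD rmorphM hornerD hornerM (rootP px) (rootP qx) mulr0 add0r.
  by move=> /esym/eqP.
by rewrite leqNgt -sp ltn_modp pn0.
Qed.

Lemma poly_over_imfrac (R : comNzRingType) (F : fieldType) (f : {rmorphism R -> F})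
    (r : {poly F}) : (forall i, r`_i \in imfrac f) ->
  exists q, map_poly (imemb (f := f)) q = r.
Proof.
move=> rf; exists (\poly_(i < size r) ImField (rf i)); apply/polyP => i.
rewrite coef_map coef_poly; case: ltnP => // ri.
by rewrite raddf0 nth_default.
Qed.

Lemma min_poly_imfrac (R : comNzRingType) (F : fieldType) (phi : {rmorphism R -> F}) x :
  algebraicOver (imemb (f := phi)) x -> exists f : {poly F},
  [/\ f \is monic, root f x, forall i, f`_i \in imfrac phi &
    forall r : {poly F}, (forall i, r`_i \in imfrac phi) -> root r x ->
      exists h, r = h * f].
Proof.
move=> /min_poly_exists[mu [mum mux mumin]].
exists (map_poly (imemb (f := phi)) mu); split=> //; first by rewrite monic_map.
  by move=> i; rewrite coef_map; apply: imvalP.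
move=> r /poly_over_imfrac[q <-] /mumin /dvdpP[h ->].
by exists (map_poly (imemb (f := phi)) h); rewrite rmorphM.
Qed.

Lemma rational_root (E F : fieldType) (e : {rmorphism E -> F}) s (u v : {poly E}) :
  ~ algebraicOver e s -> coprimep u v -> eval_at e s v != 0 ->
  integralOver (eval_at e s) (eval_at e s u / eval_at e s v) -> size v = 1.
Proof.
move=> sN uv v0 [q qm qx].
have inj w : eval_at e s w = 0 -> w = 0.
  by move=> ws; apply/eqP/contraT => w0; case: sN; exists w => //; apply/eqP.
pose m := (size q).-1.
have sq : size q = m.+1 by rewrite prednK // size_poly_gt0 monic_neq0.
pose T := \sum_(i < m) q`_i * u ^+ i * v ^+ (m - i.+1).
have vu : v %| u ^+ m.
  have -> : u ^+ m = - T * v.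
    apply/eqP; rewrite -subr_eq0 mulNr opprK; apply/eqP/inj.
    move: qx; rewrite rootE (@horner_coef_wide _ m.+1); last first.
      by rewrite -sq size_poly.
    rewrite big_ord_recr /= !coef_map /= -[q`_m]/(q`_(m.+1.-1)) -sq -lead_coefE.
    rewrite (monicP qm) rmorph1 mul1r => /eqP qx.
    apply: (mulIf (expf_neq0 m (invr_neq0 v0))); rewrite mul0r -[RHS]qx.
    rewrite /T rmorphD rmorphXn rmorphM rmorph_sum /= mulrDl addrC; congr (_ + _).
      by rewrite exprMn.
    rewrite !mulr_suml; apply: eq_bigr => i _.
    rewrite coef_map !rmorphM !rmorphXn /= exprMn -!mulrA; congr (_ * (_ * _)).
    rewrite mulrA -exprSr !exprVn subnSK //.
    have -> : eval_at e s v ^+ m = eval_at e s v ^+ (m - i) * eval_at e s v ^+ i.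
      by rewrite -exprD subnK // ltnW.
    by rewrite invfM mulrA divff ?expf_neq0 // mul1r.
  exact: dvdp_mull.
have := coprimep_dvdl vu (coprimep_expr m (etrans (coprimep_sym v u) uv)).
by rewrite coprimepp => /eqP.
Qed.

(** The units of E[s] are the constants, and E[s] is integrally closed. *)
Lemma line_unit_constant (E F : fieldType) (e : {rmorphism E -> F}) s x :
  ~ algebraicOver e s -> x \in imfrac (eval_at e s) -> x != 0 ->
  integralOver (eval_at e s) x -> integralOver (eval_at e s) x^-1 ->
  algebraicOver e x.
Proof.
move=> sN /imfracP[u [v [v0 xE]]] x0 xint xVint.
have u0 : eval_at e s u != 0 by apply: contraNneq x0 => u0; rewrite xE [X in X / _]u0 mul0r.
have vn0 : v != 0 by apply: contra_neq v0 => ->; rewrite rmorph0.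
pose d := gcdp u v; pose u' := u %/ d; pose v' := v %/ d.
have uE : u = u' * d by rewrite divpK // dvdp_gcdl.
have vE : v = v' * d by rewrite divpK // dvdp_gcdr.
have cop : coprimep u' v' by apply: coprimep_div_gcd; rewrite vn0 orbT.
move: u0 v0; rewrite {1}uE {1}vE !rmorphM /= !mulf_eq0 !negb_or.
move=> /andP[u'0 d0] /andP[v'0 _].
have {}xE : x = eval_at e s u' / eval_at e s v'.
  by rewrite xE {1}uE {1}vE !rmorphM /= -mulf_div divff // mulr1.
have sv : size v' = 1.
  by apply: rational_root sN cop v'0 _; rewrite -xE.
have su : size u' = 1.
  apply: (@rational_root _ _ _ _ v' _ sN _ u'0); first by rewrite coprimep_sym.
  by rewrite -invf_div -xE.
rewrite xE (size1_polyC (eq_leq sv)) (size1_polyC (eq_leq su)) !eval_atC.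
by apply: algebraic_div; apply: algebraic_id.
Qed.

Section PartialFamily.
Variables (K F : fieldType) (iota : {rmorphism K -> F}) (n : nat) (t : 'I_n -> F).

(** The variables outside [J] are specialized to 0 rather than dropped, so that all
    subfamilies are evaluated on the same polynomial ring. *)
Definition restrict_family (J : {set 'I_n}) (i : 'I_n) : F := if i \in J then t i else 0.

Definition subeval (J : {set 'I_n}) : {rmorphism mpoly n K -> F} :=
  mmap iota (restrict_family J).

Lemma subeval_iota J c : subeval J (mpolyC n c) = iota c.
Proof. exact: mmapC. Qed.

Lemma subeval_X (J : {set 'I_n}) i : i \in J -> subeval J (mpolyX K (mnm1 i)) = t i.
Proof. by move=> iJ; apply: etrans (mmapXi _ _ _) _; rewrite /restrict_family iJ. Qed.

Lemma subeval_in (S : subringClosed F) (J : {set 'I_n}) p : (forall c, iota c \in S) ->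
  (forall i, i \in J -> t i \in S) -> subeval J p \in S.
Proof.
move=> iS tS; apply: mmap_in => // i; rewrite /restrict_family.
by case: ifP => [/tS//|_]; apply: rpred0.
Qed.

Lemma imfrac_iota J c : iota c \in imfrac (subeval J).
Proof. by rewrite -(subeval_iota J c); apply: imfrac_id. Qed.

Lemma imfrac_mem (J : {set 'I_n}) i : i \in J -> t i \in imfrac (subeval J).
Proof. by move=> iJ; rewrite -(subeval_X iJ); apply: imfrac_id. Qed.

(** An equation for t_i over the other variables is a polynomial relation between
    all of them. *)
Lemma alg_indep_not_algebraic i : alg_indep iota t ->
  ~ algebraicOver (imemb (f := subeval (~: [set i]))) (t i).
Proof.
move=> tind /algebraic_imfrac[q q0 qt].
pose X j : mpoly n K := mpolyX K (mnm1 j).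
pose sigma : {rmorphism mpoly n K -> mpoly n K} :=
  mmap (@mpolyC n K) (fun j => if j \in ~: [set i] then X j else 0).
pose theta : {rmorphism mpoly n K -> {poly mpoly n K}} :=
  mmap (polyC \o @mpolyC n K) (fun j => if j == i then 'X else (X j)%:P).
pose phi : {rmorphism mpoly n K -> F} := mmap iota t.
have phis p : phi (sigma p) = subeval (~: [set i]) p.
  rewrite [LHS]rmorph_mmap; apply: mmap_ext => [c|j]; first exact: mmapC.
  rewrite /restrict_family; case: ifP => _; last exact: rmorph0.
  exact: mmapXi.
(* sigma removes the i-th variable, theta singles it out *)
have thetas p : theta (sigma p) = (sigma p)%:P.
  rewrite [LHS]rmorph_mmap [RHS]rmorph_mmap; apply: mmap_ext => [c|j]; first exact: mmapC.
  rewrite !inE; case: eqP => [_|/eqP/negPf ji] /=; first exact: rmorph0.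
  by rewrite [LHS]mmapXi ji.
have pp0 : (map_poly sigma q).[X i] = 0.
  apply: tind; rewrite -[LHS]/(phi _) -horner_map -map_poly_comp.
  rewrite [phi (X i)]mmapXi; apply/eqP; rewrite -[_ == _]/(root _ _).
  by rewrite (eq_map_poly phis).
have sq0 : map_poly sigma q = 0.
  have := congr1 theta pp0; rewrite rmorph0 -horner_map -map_poly_comp.
  rewrite [theta (X i)]mmapXi eqxx (eq_map_poly thetas) => <-.
  by rewrite (map_poly_comp polyC sigma) -/(_ \Po 'X) comp_polyXr.
case/negP: q0; rewrite -(eq_map_poly phis) map_poly_comp sq0.
by rewrite raddf0.
Qed.

(** Take J minimal such that c is algebraic over K(t_J), and i in J.  By exchange,
    t_i is algebraic over K(t_J') (c), where J' is J without i.  If c were algebraic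
    over the field of all variables but t_i, so would t_i be. *)
Lemma alg_indep_pick c : alg_indep iota t ->
  algebraicOver (imemb (f := subeval [set: 'I_n]%SET)) c -> ~ algebraicOver iota c ->
  exists i, ~ algebraicOver (imemb (f := subeval (~: [set i]))) c.
Proof.
move=> tind cT cN.
pose A (J : {set 'I_n}) := `[< algebraicOver (imemb (f := subeval J)) c >].
have [|J /minsetP[/asboolP cJ Jmin] _] := @minset_exists _ A [set: 'I_n]%SET.
  exact/asboolP.
have [J0|[i iJ]] := set_0Vmem J.
  case: cN; apply: algebraic_trans cJ => r; apply: imemb_algebraic => p.
  suff /imfracP[a [b [_ ->]]] : subeval J p \in imfrac iota.
    by rewrite -fmorph_div; apply: integral_id.
  by apply: subeval_in => [c'|j]; [exact: imfrac_id|rewrite J0 inE].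
exists i => cE; apply: (@alg_indep_not_algebraic i tind).
set g := subeval (~: [set i]) in cE *.
pose l : {rmorphism imfield (subeval (J :\ i)) -> F} := imemb (f := subeval (J :\ i)).
have lC y : l y \in imfrac (eval_at l (t i)).
  by have := imfrac_id (eval_at l (t i)) y%:P; rewrite [X in X \in _]eval_atC.
have cli : algebraicOver (imemb (f := eval_at l (t i))) c.
  apply: algebraic_sub_range cJ => r.
  suff rS : imval r \in imfrac (eval_at l (t i)) by exists (ImField rS).
  apply: imfrac_sub (imvalP r) => p; apply: subeval_in => [c'|j jJ].
    exact: (lC (ImField (imfrac_iota (J :\ i) c'))).
  have [->|ji] := eqVneq j i.
    by rewrite -[X in X \in _](eval_atX l); apply: imfrac_id.
  have jJi : j \in J :\ i by rewrite !inE ji.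
  exact: (lC (ImField (imfrac_mem jJi))).
have clN : ~ algebraicOver l c.
  move=> /asboolP/Jmin/(_ (finset.subsetDl _ _)) JE; move: iJ.
  by rewrite -JE !inE eqxx.
have til := exchange cli clN.
have lg r : algebraicOver (imemb (f := g)) (l r).
  have rS : l r \in imfrac g.
    apply: imfrac_sub (imvalP r) => p; apply: subeval_in => [c'|j].
      exact: imfrac_iota.
    by rewrite in_setD1 => /andP[ji _]; apply: imfrac_mem; rewrite !inE.
  exact: (algebraic_id (imemb (f := g)) (ImField rS)).
apply: algebraic_trans til => r; apply: imemb_algebraic => p.
by apply: integral_eval => [y|]; apply/integral_algebraic.
Qed.
End PartialFamily.

(** * Vanishing conditions and density *)

Section Specialization.
Variables (K F : fieldType) (iota : {rmorphism K -> F}) (P : place iota).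
Variables (n : nat) (t : 'I_n -> F) (b : F).
Hypotheses (tind : alg_indep iota t) (tP : forall i, t i \in place_ring P).
Hypotheses (b0 : b != 0) (Pb : P b = Some 0).
Hypothesis bint : integralOver (mmap iota t) b.

Let phi : {rmorphism mpoly n K -> F} := mmap iota t.

Let phiP r : phi r \in place_ring P.
Proof. by apply: mmap_in => // c; apply: place_ring_iota. Qed.

Let balg : algebraicOver (imemb (f := phi)) b.
Proof. exact: integral_algebraic_imfrac bint. Qed.

(** Let c be the constant coefficient of the minimal polynomial f of b over K(t).
    As b is integral over K[t], so are the coefficients of f; hence they are
    integral at P, and f(b) = 0 gives c the value 0 at P.  So c is transcendental
    over K, and some i makes it transcendental over the field E generated by the
    other variables.  If 1/b were integral over E[t_i], f would divide a polynomial
    with constant coefficient 1 and coefficients integral over E[t_i], so that 1/c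
    would be integral too, and c would be a unit of E[t_i], i.e. a constant. *)
Lemma line_with_nonunit : exists i,
  ~ integralOver (eval_at (imemb (f := subeval iota t (~: [set i]))) (t i)) b^-1.
Proof.
have [f [fm fb fphi fmin]] := min_poly_imfrac balg.
have iphi c : exists r, iota c = phi r by exists (mpolyC n c); rewrite [RHS]mmapC.
have fint i : integralOver phi f`_i.
  have [q qm qb] := bint.
  have [|h hE] := fmin (map_poly phi q) _ qb.
    by move=> i'; rewrite coef_map; apply: imfrac_id.
  have hm : lead_coef h = 1.
    have := lead_coefM h f; rewrite -hE (monicP (monic_map phi qm)).
    by rewrite (monicP fm) mulr1.
  apply: (factor_integral iphi _ hm) => i'; rewrite -hE coef_map.
  exact: integral_id.
pose c := f`_0.
have [g fE] : exists g, f = g * 'X + c%:P.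
  have /factor_theorem[g gE] : root (f - c%:P) 0.
    by rewrite rootE hornerD hornerN hornerC horner_coef0 subrr.
  by exists g; rewrite -[f in LHS](subrK c%:P) gE subr0.
have c0 : c != 0.
  apply/eqP => c0; have gb : root g b.
    move: fb; rewrite fE c0 addr0 rootM rootX (negPf b0) orbF //.
  have g0 : g != 0.
    by apply: contraTneq (monic_neq0 fm) => g0; rewrite fE c0 g0 mul0r addr0 eqxx.
  have [|h hE] := fmin g _ gb.
    by move=> i; have := fphi i.+1; rewrite fE coefD coefMX coefC /= addr0.
  have h0 : h != 0 by apply: contra_neq g0 => h0; rewrite hE h0 mul0r.
  have sf : size f = (size g).+1 by rewrite fE c0 addr0 size_mulX.
  have sg : size g = size (h * f) by rewrite -hE.
  move: sg; rewrite size_Mmonic // sf addnS /= => /eqP.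
  by rewrite ltn_eqF // -[X in (X < _)%N]add0n ltn_add2r size_poly_gt0.
have Pc : P c = Some 0.
  have gP i : g`_i \in place_ring P.
    have -> : g`_i = f`_i.+1 by rewrite fE coefD coefMX coefC /= addr0.
    exact: place_integral phiP (fint _).
  have gbP : g.[b] \in place_ring P.
    by rewrite rpred_horner ?place_ring0 //; apply/polyOverP.
  have /place_ringP[a Pgb] := gbP.
  have : c = - (g.[b] * b).
    apply/eqP; rewrite -subr_eq0 opprK addrC; move: fb.
    by rewrite rootE fE hornerD hornerC hornerMX.
  move=> ->; rewrite -[- _]add0r -[X in Some X](subr0 0).
  by apply: placeB; [exact: place0|rewrite -(mulr0 a); apply: placeM].
have cT : algebraicOver (imemb (f := subeval iota t [set: 'I_n]%SET)) c.
  have cS : c \in imfrac (subeval iota t [set: 'I_n]%SET).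
    apply: imfrac_sub (fphi 0) => p; apply: mmap_in => [a|i].
      exact: imfrac_iota.
    by apply: imfrac_mem; rewrite inE.
  exact: (algebraic_id (imemb (f := subeval iota t [set: 'I_n]%SET)) (ImField cS)).
have cN : ~ algebraicOver iota c := place_not_algebraic Pc c0.
have [i ciN] := alg_indep_pick tind cT cN; exists i => bVint.
set l := imemb (f := subeval iota t (~: [set i])) in ciN bVint.
pose ll : {rmorphism imfield (subeval iota t (~: [set i])) -> F} := l.
pose gg := eval_at ll (t i).
have ggl y : integralOver gg (ll y) by exact: integral_eval_const.
have ggi : integralOver gg (t i) by exact: integral_eval_var.
have iotal a : iota a = ll (ImField (imfrac_iota iota t (~: [set i]) a)) by [].
have tl j : j != i -> exists y, t j = ll y.
  move=> ji; have jS : j \in ~: [set i] by rewrite !inE.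
  by exists (ImField (imfrac_mem iota t jS)).
have phigg r : integralOver gg (phi r).
  apply: integral_mmap => [a|j]; first by rewrite iotal.
  by have [->//|/tl[y ->]] := eqVneq j i.
have phiimf x : x \in imfrac phi -> x \in imfrac gg.
  apply: imfrac_sub => r; apply: mmap_in => [a|j].
    by rewrite iotal -(eval_atC ll (t i)); apply: imfrac_id.
  have [->|/tl[y ->]] := eqVneq j i.
    by rewrite -[X in X \in _](eval_atX ll); apply: imfrac_id.
  by rewrite -(eval_atC ll (t i)); apply: imfrac_id.
have cphi : c \in imfrac gg by apply: phiimf; apply: fphi.
have iotagg y : exists r, ll y = gg r.
  by exists y%:P; apply: esym (eval_atC _ _ _).
have tiN : ~ algebraicOver ll (t i) by apply: alg_indep_not_algebraic.
apply: ciN; apply: (line_unit_constant tiN cphi c0).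
  exact: integral_trans phigg (fint 0).
have [q qm qb] := bVint.
(* the reversed polynomial of q annihilates b and has constant coefficient 1 *)
pose m := (size q).-1.
have sq : size q = m.+1 by rewrite prednK // size_poly_gt0 monic_neq0.
pose r := \poly_(i < m.+1) gg q`_(m - i).
have ggphi r' : gg r' \in imfrac phi.
  apply: eval_at_in => [y|]; last by rewrite -[t i](mmapXi iota t); apply: imfrac_id.
  apply: imfrac_sub (imvalP y) => p; apply: subeval_in => [a|j _].
    by rewrite -(mmapC t iota a); apply: imfrac_id.
  by rewrite -[t j](mmapXi iota t); apply: imfrac_id.
have rcoef k : r`_k = if (k < m.+1)%N then gg q`_(m - k) else 0 by rewrite coef_poly.
have [||h hE] := fmin r.
- by move=> k; rewrite rcoef; case: ifP => _; rewrite ?rpred0.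
- rewrite rootE horner_poly; move: qb; rewrite rootE (@horner_coef_wide _ m.+1); last first.
    by rewrite -sq size_poly.
  move=> /eqP qb; apply/eqP/(mulfI (expf_neq0 m (invr_neq0 b0))).
  rewrite mulr0 -[RHS]qb mulr_sumr (reindex_inj rev_ord_inj) /=.
  apply: eq_bigr => k _; rewrite subSS coef_map subKn; last by rewrite -ltnS.
  rewrite mulrCA; congr (_ * _).
  have -> : b^-1 ^+ m = b^-1 ^+ (m - k) * b^-1 ^+ k by rewrite -exprD subnK // -ltnS.
  by rewrite mulrAC -exprMn mulVf // expr1n mul1r.
have hc : h`_0 * c = 1.
  have := rcoef 0; rewrite hE coef0M subn0 /= => ->.
  have -> : q`_m = 1 by have := monicP qm; rewrite lead_coefE.
  exact: rmorph1.
have -> : c^-1 = h`_0.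
  by apply: (mulIf c0); rewrite hc mulVf.
apply: (factor_integral iotagg (f := f) (k := (size f).-1)); last first.
  by rewrite -lead_coefE; apply: monicP.
move=> k; rewrite mulrC -hE rcoef; case: ifP => _; last exact: integral0.
exact: integral_id.
Qed.
End Specialization.

(** Normalize [b :: a] together with generators of F, or their inverses, inside the
    valuation ring of P.  The line found above carries a place of F, trivial on E,
    where b vanishes and the elements of [a] stay finite; its residue field is
    finite over E, which is finitely generated, so that it has a place of the
    required kind. *)
Lemma specialize_place (K F : fieldType) (iota : {rmorphism K -> F}) (P : place iota)
    (a : seq F) b :
  finitely_generated_field iota -> {subset a <= place_ring P} -> b != 0 -> P b = Some 0 ->
  exists Q : place iota, [/\ value_group_fg Q, residue_finite Q,
    {subset a <= place_ring Q} & Q b = Some 0].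
Proof.
move=> [gens gensP] aP b0 Pb.
pose gens' := [seq if x \in place_ring P then x else x^-1 | x <- gens].
have [||n [t [tind tP tint]]] := @noether_normalization _ _ iota (place_ring P) (b :: a ++ gens').
- exact: place_ring_iota.
- move=> x; rewrite inE mem_cat => /or3P[/eqP->|/aP//|/mapP[y _ ->]].
    exact: place_ring0.
  by case: ifP => // /negbT/place_ring_invP.
have bint : integralOver (mmap iota t) b by apply: tint; rewrite mem_head.
have [i bN] := line_with_nonunit tind tP b0 Pb bint.
set phi := mmap iota t in tint bint.
set g := subeval iota t (~: [set i]) in bN.
pose l : {rmorphism imfield g -> F} := imemb (f := g).
have iotal c : iota c = l (to_imfield g (mpolyC n c)).
  by rewrite -[RHS]/(g (mpolyC n c)) /g subeval_iota.
have tl j : j != i -> exists y, t j = l y.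
  move=> ji; have jS : j \in ~: [set i] by rewrite !inE.
  by exists (ImField (imfrac_mem iota t jS)).
have lint y : integralOver (eval_at l (t i)) (l y) by exact: integral_eval_const.
have tiint : integralOver (eval_at l (t i)) (t i) by exact: integral_eval_var.
have phint r : integralOver (eval_at l (t i)) (phi r).
  apply: integral_mmap => [c|j]; first by rewrite iotal.
  by have [->//|/tl[y ->]] := eqVneq j i.
have lalg y : algebraicOver (imemb (f := eval_at l (t i))) y.
  (* the elements algebraic over E(t_i) form a subfield containing the generators *)
  pose L : {rmorphism imfield (eval_at l (t i)) -> F} := imemb (f := eval_at l (t i)).
  pose S : {pred F} := [pred x | `[< algebraicOver L x >]].
  have SP x : x \in S <-> algebraicOver L x by split=> /asboolP.
  have intS x : integralOver (eval_at l (t i)) x -> algebraicOver L x.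
    exact: integral_algebraic_imfrac.
  apply/SP; apply: gensP => [|c|x xg].
  - split=> [|x y' /SP Sx /SP Sy|x y' /SP Sx /SP Sy]; apply/SP.
    + exact: algebraic1.
    + exact: algebraic_sub.
    exact: algebraic_div.
  - by apply/SP/intS; rewrite iotal.
  have : algebraicOver L (if x \in place_ring P then x else x^-1).
    apply/intS; apply: integral_trans phint _; apply: tint.
    by rewrite inE mem_cat (map_f (fun x => if x \in place_ring P then x else x^-1) xg) !orbT.
  by case: ifP => _ xalg; apply/SP => //; rewrite -[x]invrK; apply: algebraic_inv.
have [|W [WE Wb]] := chevalley (iota := l) _ bN.
  by move=> y; exists y%:P; exact: esym (eval_atC _ _ _).
have Wb0 : W b = Some 0 by rewrite -[b]invrK; apply: placeV.
have fgl : finitely_generated_field l.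
  by exists gens => S Sd Sl Sg; apply: gensP => // c; rewrite iotal.
have [Wvg Wfin] := curve_place_small fgl lalg Wb0 b0.
have aW x : x \in a -> x \in place_ring W.
  move=> xa; apply: (place_integral WE); apply: integral_trans phint _; apply: tint.
  by rewrite inE mem_cat xa orbT.
pose k : {rmorphism K -> imfield g} := to_imfield g \o @mpolyC n K.
have iotak c : iota c = l (k c) := iotal c.
have [Q [Qvg Qfin Qa]] := small_place_exists (k := k) (imfield_generated (f := g)) Wfin
  (iota := residue_emb W \o k) (fun=> erefl) [seq odflt 0 (W x) | x <- a].
exists (comp_place iotak Q); split=> //; first exact: comp_value_group_fg.
  move=> x xa; have /place_ringP[c Wx] := aW x xa.
  rewrite inE comp_placeE Wx /=; apply: Qa; apply/mapP; exists x => //.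
  by rewrite Wx.
by rewrite comp_placeE Wb0 /= place0.
Qed.

(** The case without vanishing conditions. *)
Lemma small_place_of_fg (K F : fieldType) (iota : {rmorphism K -> F}) (a : seq F) :
  finitely_generated_field iota ->
  exists Q : place iota, [/\ value_group_fg Q, residue_finite Q & {subset a <= place_ring Q}].
Proof.
move=> [gens gensP].
apply: (@small_place_exists _ K F iota (tnth (in_tuple gens)) _ F idfun) => //.
  move=> y; apply: gensP => [|c|x /(tnthP (in_tuple gens))[i ->]].
  - exact: imfrac_closed.
  - by rewrite -(mmapC (tnth (in_tuple gens)) iota c); apply: imfrac_id.
  by rewrite -(mmapXi iota (tnth (in_tuple gens))); apply: imfrac_id.
by exists 1, (fun=> 1) => x; exists (fun=> x); rewrite big_ord1 mulr1.
Qed.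

(** Several vanishing conditions reduce to one: keep an element of largest value
    among the b_j, and ask for the quotients of the others by it to be finite. *)
Lemma patch_small_place (K F : fieldType) (iota : {rmorphism K -> F}) (P : place iota)
    (a b : seq F) : finitely_generated_field iota ->
  {subset a <= place_ring P} -> {in b, forall x, P x = Some 0} ->
  exists Q : place iota, [/\ value_group_fg Q, residue_finite Q,
    {subset a <= place_ring Q} & {in b, forall x, Q x = Some 0}].
Proof.
move=> fg aP bP.
have [bn0|nb] := pselect (exists i : 'I_(size b), b`_i != 0); last first.
  have [Q [Qvg Qfin Qa]] := small_place_of_fg a fg; exists Q; split=> // x /(nthP 0)[i ib <-].
  have -> : b`_i = 0; last exact: place0.
  by apply/eqP/contraT => bi; case: nb; exists (Ordinal ib).
have [i bi bmax] := place_max P (x := fun i : 'I_(size b) => b`_i) bn0.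
have [|||Q [Qvg Qfin Qa Qb]] := @specialize_place _ _ _ P (a ++ [seq x / b`_i | x <- b]) b`_i fg.
- move=> x; rewrite mem_cat => /orP[/aP//|/mapP[_ /(nthP 0)[j jb <-] ->]].
  exact: (bmax (Ordinal jb)).
- exact: bi.
- by apply/bP/mem_nth.
exists Q; split=> // x xb; first by apply: Qa; rewrite mem_cat xb.
have /place_ringP[c Qc] : x / b`_i \in place_ring Q.
  by apply: Qa; rewrite mem_cat (map_f (fun x => x / b`_i) xb) orbT.
by rewrite -[x](divfK bi) -(mulr0 c); apply: placeM.
Qed.

(** A single element of a finite extension is already algebraically dependent. *)
Lemma finite_trdeg0 (K F : fieldType) (iota : {rmorphism K -> F}) :
  finite_extension iota -> trdeg_eq iota 0.
Proof.
move=> fin; split; first by exists (fun=> 0); apply: alg_indep_ord0.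
move=> [//|m] t tind; have [q q0 qt] := finite_algebraic fin (t ord0).
pose theta : {rmorphism mpoly m.+1 K -> {poly K}} := mmap (@polyC K) (fun=> 'X).
pose C : {rmorphism K -> mpoly m.+1 K} := @mpolyC m.+1 K.
pose phi : {rmorphism mpoly m.+1 K -> F} := mmap iota t.
have p0 : (map_poly C q).[mpolyX K (mnm1 ord0)] = 0.
  apply: tind; rewrite -[LHS]/(phi _) -horner_map -map_poly_comp.
  rewrite [phi (mpolyX _ _)]mmapXi; apply/eqP; rewrite -[_ == _]/(root _ _).
  by rewrite (eq_map_poly (g := iota)) // => c; apply: mmapC.
have := congr1 theta p0; rewrite rmorph0 -horner_map -map_poly_comp.
rewrite [theta (mpolyX _ _)]mmapXi (eq_map_poly (g := polyC)); last first.
  by move=> c; apply: mmapC.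
by rewrite -/(_ \Po 'X) comp_polyXr => q00; rewrite q00 eqxx in q0.
Qed.

Section EquivalentPlaces.
Variables (K F : fieldType) (iota : {rmorphism K -> F}) (Q R : place iota).
Hypothesis QR : val_ring Q = val_ring R.

Lemma equiv_value_group_fg : value_group_fg Q -> value_group_fg R.
Proof. by rewrite /value_group_fg /same_value QR. Qed.

Lemma equiv_max_ideal x : Q x = Some 0 -> R x = Some 0.
Proof.
by move=> Qx; apply/max_idealP; rewrite -QR; apply/max_idealP.
Qed.

Lemma equiv_residue_finite : residue_finite Q -> residue_finite R.
Proof.
move=> [n [e eE]]; have [s [s' _ sK] sE] := (place_equivP Q R).2 QR.
exists n, (fun i => s (e i)) => x; have [c cE] := eE (s' x); exists c.
rewrite -[LHS]sK cE rmorph_sum; apply: eq_bigr => i _; rewrite rmorphM; congr (_ * _).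
by have := sE (iota (c i)); rewrite !placeK => -[].
Qed.
End EquivalentPlaces.

Local Open Scope classical_set_scope.

Theorem corollary8 (K F : fieldType) (iota : {rmorphism K -> F})
    (hF : function_field iota) :
  dense [set P : place_class iota |
    [/\ zero_dimensional_place (repr_place P),
        value_group_fg (repr_place P) &
        residue_finite (repr_place P)]].
Proof.
move=> O [P OP] [D _ OE].
move: OP; rewrite -OE => -[[a b] Dab [Pa Pb]].
have [Q [Qvg Qfin Qa Qb]] := patch_small_place hF.1 Pa Pb.
have QR : val_ring Q = val_ring (repr_place (class_of Q)) by rewrite val_ring_repr.
exists (class_of Q); split.
  exists (a, b) => //; split=> x xab; first by rewrite -QR; apply: Qa.
  rewrite /max_ideal /=; apply: (equiv_max_ideal QR); exact: Qb.
have Rfin := equiv_residue_finite QR Qfin.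
split=> //; first exact: finite_trdeg0.
exact: equiv_value_group_fg QR Qvg.
Qed.
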